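(* Let $\Omega\subseteq\mathbb R^n$, $n\ge 2$, be a connected open set, and let $V\in L^n_{loc}(\Omega)$. Let $u=(u_1,\ldots,u_M):\Omega\to\mathbb R^M$ satisfy $u\in H^1_{loc}(\Omega)$ and $|\nabla u|\le V|u|$ a.e. on $\Omega$. If $u$ vanishes to infinite order (in the $L^2$ sense) at some $x_0\in\Omega$, then $u\equiv 0$ on $\Omega$ (i.e. $u=0$ a.e.).
   Context: $H^1_{loc}(\Omega)=W^{1,2}_{loc}(\Omega)$ (componentwise), with $\nabla u$ the weak gradient; for $u:\Omega\to\mathbb R^M$, $|u|=\left(\sum_{k=1}^M|u_k|^2\right)^{1/2}$ and $|\nabla u|=\left(\sum_{j=1}^n\sum_{k=1}^M|\partial_{x_j}u_k|^2\right)^{1/2}$. A function $u\in L^2_{loc}(\Omega)$ vanishes to infinite order at $x_0$ in the $L^2$ sense if for all $m\ge 0$, $\lim_{r\to0}r^{-m}\int_{|x-x_0|<r}|u(x)|^2\,dv=0$, where $dv$ is Lebesgue measure. *)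

(* Defs.v *)
From HB Require Import structures.
From mathcomp Require Import all_boot all_order all_algebra.
From mathcomp Require Import all_classical all_reals all_analysis.

Set Implicit Arguments.
Unset Strict Implicit.
Unset Printing Implicit Defensive.

Import Order.TTheory GRing.Theory Num.Theory.
Import numFieldNormedType.Exports.

Local Open Scope classical_set_scope.
Local Open Scope ring_scope.

Definition measure_row_display : measure_display.
Proof. exact: default_measure_display. Qed.

Section measurable_row.
Context (R : realType) (n : nat).

Definition row_coord (i : 'I_n) (x : 'rV[R]_n) : R := x ord0 i.

Let row_set0 : g_sigma_preimage row_coord set0.
Proof. exact: sigma_algebra0. Qed.

Let row_setC A : g_sigma_preimage row_coord A ->
  g_sigma_preimage row_coord (~` A).
Proof. exact: sigma_algebraC. Qed.

Let row_bigcup (F : _^nat) : (forall i, g_sigma_preimage row_coord (F i)) ->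
  g_sigma_preimage row_coord (\bigcup_i (F i)).
Proof. exact: sigma_algebra_bigcup. Qed.

(* The product of the Borel sigma-algebras, i.e. the Borel sets of R^n. *)
HB.instance Definition _ := @isMeasurable.Build measure_row_display
  'rV[R]_n (g_sigma_preimage row_coord) row_set0 row_setC row_bigcup.

Lemma measurable_row_coord i : measurable_fun [set: 'rV[R]_n] (row_coord i).
Proof.
move=> _ Y mY; rewrite setTI; apply: sub_sigma_algebra => /=.
rewrite -bigcup_seq/=; exists i => /=; first by rewrite mem_index_enum.
by exists Y => //; rewrite setTI.
Qed.

Lemma measurable_row_box (A : 'I_n -> set R) : (forall i, measurable (A i)) ->
  measurable [set x : 'rV[R]_n | forall i, A i (x ord0 i)].
Proof.
move=> mA.
have -> : [set x : 'rV[R]_n | forall i, A i (x ord0 i)] =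
    \bigcap_(i in [set: 'I_n]) (row_coord i @^-1` A i).
  by apply/seteqP; split => x /= H i; [move=> _|]; exact: H.
apply: fin_bigcap_measurable => // i _.
by rewrite -[X in measurable X]setTI; exact: measurable_row_coord.
Qed.

Lemma open_measurable_row (U : set 'rV[R]_n) : open U -> measurable U.
Proof.
move=> oU.
pose B (q : {ffun 'I_n -> rat * rat}) := [set x : 'rV[R]_n |
  forall i, `]ratr (q i).1, ratr (q i).2[%classic (x ord0 i)].
have -> : U = \bigcup_q (if asbool (B q `<=` U) then B q else set0).
  apply/seteqP; split => [x Ux|x [q _]]; last by case: asboolP => // BU /BU.
  have /nbhs_ballP[e /= e0 xeU] := open_nbhs_nbhs (conj oU Ux).
  have /choice[q Hq] : forall i : 'I_n, exists p : rat * rat,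
      (ratr p.1 \in `]x ord0 i - e, x ord0 i[) /\
      (ratr p.2 \in `]x ord0 i, x ord0 i + e[).
    move=> i.
    have /rat_in_itvoo[a ?] : x ord0 i - e < x ord0 i by rewrite gtrBl.
    have /rat_in_itvoo[b ?] : x ord0 i < x ord0 i + e by rewrite ltrDl.
    by exists (a, b).
  exists [ffun i => q i] => //; case: asboolP => [_ i /=|].
    by rewrite ffunE in_itv /=; have [/itvP-> /itvP->] := Hq i.
  case=> y By; apply: xeU; split => // i j; rewrite ord1.
  have := By j; rewrite /= ffunE in_itv /= => /andP[qy yq].
  have [] := Hq j; rewrite !in_itv /= => /andP[xq _] /andP[_ qx].
  rewrite /ball /= ltr_distlC (lt_trans xq qy).
  exact: lt_trans yq qx.
apply: countable_bigcupT_measurable.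
  exact: (@countableP {ffun 'I_n -> rat * rat}%type).
move=> q; case: ifP => // _.
by apply: (@measurable_row_box (fun i => `]ratr (q i).1, ratr (q i).2[%classic)).
Qed.

Lemma measurable_fun_row d (T : measurableType d) (f : T -> 'rV[R]_n) :
  (forall i, measurable_fun [set: T] (row_coord i \o f)) ->
  measurable_fun [set: T] f.
Proof.
move=> mf _ A mA; rewrite setTI.
have: g_sigma_preimage (fun i => row_coord i \o f) (f @^-1` A).
  by rewrite g_sigma_preimage_comp; exists A => //; rewrite setTI.
apply: smallest_sub; first exact: sigma_algebra_measurable.
rewrite -bigcup_seq => B [i _ [C mC <-]].
exact: mf.
Qed.

End measurable_row.

Section cons_row.
Context (R : realType) (n : nat).

Definition cons_row (p : R * 'rV[R]_n) : 'rV[R]_n.+1 :=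
  row_mx (p.1)%:M p.2.

Definition uncons_row (x : 'rV[R]_n.+1) : R * 'rV[R]_n :=
  (x ord0 ord0, \row_j x ord0 (lift ord0 j)).

Lemma cons_row0 p : cons_row p ord0 ord0 = p.1.
Proof.
rewrite /cons_row; have -> : ord0 = lshift n (ord0 : 'I_1) by exact: val_inj.
by rewrite (row_mxEl (p.1)%:M p.2) mxE eqxx mulr1n.
Qed.

Lemma cons_rowS p j : cons_row p ord0 (lift ord0 j) = p.2 ord0 j.
Proof.
rewrite /cons_row.
have -> : lift ord0 j = rshift 1 j :> 'I_(1 + n) by exact: val_inj.
exact: (row_mxEr (p.1)%:M p.2).
Qed.

Lemma cons_rowK : cancel cons_row uncons_row.
Proof.
move=> p; rewrite /uncons_row cons_row0; case: p => a v /=; congr pair.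
by apply/rowP => j; rewrite mxE cons_rowS.
Qed.

Lemma uncons_rowK : cancel uncons_row cons_row.
Proof.
move=> x; apply/rowP => i; case: (unliftP ord0 i) => [j|] ->.
  by rewrite cons_rowS mxE.
by rewrite cons_row0.
Qed.

Lemma measurable_cons_row : measurable_fun [set: R * 'rV[R]_n] cons_row.
Proof.
apply: measurable_fun_row => i; case: (unliftP ord0 i) => [j|] ->.
  rewrite (_ : _ \o _ = row_coord j \o snd); last first.
    by apply/funext => p; rewrite /row_coord /= cons_rowS.
  by apply: measurableT_comp; [exact: measurable_row_coord|exact: measurable_snd].
rewrite (_ : _ \o _ = fst); last first.
  by apply/funext => p; rewrite /row_coord /= cons_row0.
exact: measurable_fst.
Qed.

Lemma measurable_uncons_row : measurable_fun [set: 'rV[R]_n.+1] uncons_row.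
Proof.
apply: measurable_fun_pair; first exact: (measurable_row_coord (ord0 : 'I_n.+1)).
apply: measurable_fun_row => j.
rewrite (_ : _ \o _ = row_coord (lift ord0 j)); last first.
  by apply/funext => x; rewrite /row_coord /= mxE.
exact: measurable_row_coord.
Qed.

Variable m : {sigma_finite_measure set 'rV[R]_n -> \bar R}.

Definition cons_row_measure : set 'rV[R]_n.+1 -> \bar R :=
  pushforward (@lebesgue_measure R \x m)%E cons_row.

Let cons_row_measure0 : cons_row_measure set0 = 0%E.
Proof. by rewrite /cons_row_measure /pushforward preimage_set0 measure0. Qed.

Let cons_row_measure_ge0 A : (0 <= cons_row_measure A)%E.
Proof. by rewrite /cons_row_measure /pushforward measure_ge0. Qed.

Let cons_row_measure_sigma_additive : semi_sigma_additive cons_row_measure.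
Proof.
move=> F mF tF mUF; rewrite /cons_row_measure /pushforward preimage_bigcup.
apply: measure_semi_sigma_additive.
- by move=> i; rewrite -[X in measurable X]setTI; exact: measurable_cons_row.
- apply/trivIsetP => /= i j _ _ ij; rewrite -preimage_setI.
  by move/trivIsetP : tF => /(_ i j Logic.I Logic.I ij) ->; rewrite preimage_set0.
- by rewrite -preimage_bigcup -[X in measurable X]setTI;
    exact: measurable_cons_row.
Qed.

HB.instance Definition _ := isMeasure.Build _ _ _ cons_row_measure
  cons_row_measure0 cons_row_measure_ge0 cons_row_measure_sigma_additive.

Let cons_row_measure_sigma_finite : sigma_finite setT cons_row_measure.
Proof.
have /sigma_finiteP[F [TF ndF Foo]] := sigma_finiteT (@lebesgue_measure R).
have /sigma_finiteP[G [TG ndG Goo]] := sigma_finiteT m.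
exists (fun i => uncons_row @^-1` (F i `*` G i)).
  apply/seteqP; split=> // x _.
  have : setT (uncons_row x).1 by [].
  rewrite TF => -[i _ Fi].
  have : setT (uncons_row x).2 by [].
  rewrite TG => -[k _ Gk].
  exists (maxn i k) => //; split.
  - by move: Fi; exact/subsetPset/ndF/leq_maxl.
  - by move: Gk; exact/subsetPset/ndG/leq_maxr.
move=> i; have [? ?] := Foo i; have [? ?] := Goo i; split.
  rewrite -[X in measurable X]setTI; apply: measurable_uncons_row => //.
  exact: measurableX.
rewrite /cons_row_measure /pushforward -comp_preimage.
rewrite (_ : _ \o _ = idfun) ?preimage_id; last first.
  by apply/funext => p; exact: cons_rowK.
by rewrite product_measure1E// lte_mul_pinfty// ge0_fin_numE.
Qed.

HB.instance Definition _ := Measure_isSigmaFinite.Build _ _ _ cons_row_measure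
  cons_row_measure_sigma_finite.

End cons_row.

(* Lebesgue measure on the Borel sets of R^n, as an iterated product. *)
Fixpoint lebesgue_row (R : realType) (n : nat) :
    {sigma_finite_measure set 'rV[R]_n -> \bar R} :=
  match n with
  | 0 => \d_(0 : 'rV[R]_0)
  | n'.+1 => cons_row_measure (lebesgue_row R n')
  end.

Lemma lebesgue_row_box (R : realType) (n : nat) (A : 'I_n -> set R) :
  (forall i, measurable (A i)) ->
  lebesgue_row R n [set x | forall i, A i (x ord0 i)] =
  (\prod_(i < n) lebesgue_measure (A i))%E.
Proof.
elim: n A => [|n IH] A mA.
  by rewrite big_ord0 /= diracE mem_set // => -[].
rewrite big_ord_recl -IH //= /cons_row_measure /pushforward.
rewrite -product_measure1E //.
- congr (_ _); apply/seteqP; split => [[a v] /= H|[a v] /= [H0 HS] i].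
    split; first by have := H ord0; rewrite cons_row0.
    by move=> i; have := H (lift ord0 i); rewrite cons_rowS.
  by case: (unliftP ord0 i) => [j|] ->; rewrite ?cons_rowS ?cons_row0.
- exact: mA.
- exact: (measurable_row_box (fun i => mA (lift ord0 i))).
Qed.

Section function_spaces.
Context (R : realType) (n : nat).
Local Notation mu := (lebesgue_row R n).
Implicit Types (Omega D : set 'rV[R]_n) (f g phi : 'rV[R]_n -> R).

(* The norm `|_| of the library on matrices is the sup norm. *)
Definition enorm (p q : nat) (A : 'M[R]_(p, q)) : R :=
  Num.sqrt (\sum_(i < p) \sum_(j < q) `|A i j| ^+ 2).

Definition eball (x0 : 'rV[R]_n) (r : R) : set 'rV[R]_n :=
  [set x | enorm (x - x0) < r].

(* Measurability with respect to the completion of the Borel sets: a function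
   is Lebesgue measurable iff it is a.e. equal to a Borel function.  The
   library's integral of such a function is that of its Borel version. *)
Definition lebesgue_measurable_fun D f : Prop :=
  exists2 g, measurable_fun D g & ae_eq mu D f g.

Definition Lp_loc (p : nat) Omega f : Prop :=
  lebesgue_measurable_fun Omega f /\
  forall K : set 'rV[R]_n, compact K -> K `<=` Omega ->
    (\int[mu]_(x in K) (`|f x| ^+ p)%:E < +oo)%E.

Definition partial (j : 'I_n) f : 'rV[R]_n -> R := 'D_(delta_mx ord0 j) f.

Definition smooth f : Prop :=
  forall s : seq 'I_n, let g := foldr partial f s in
    continuous g /\
    forall (x : 'rV[R]_n) (j : 'I_n), derivable g x (delta_mx ord0 j).

Definition test_function Omega phi : Prop :=
  let supp := closure [set x | phi x != 0] in
  [/\ smooth phi, compact supp & supp `<=` Omega].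

Definition is_weak_partial Omega (j : 'I_n) f g : Prop :=
  [/\ Lp_loc 1 Omega f, Lp_loc 1 Omega g &
    forall phi, test_function Omega phi ->
      (\int[mu]_(x in Omega) (f x * partial j phi x)%:E =
       - \int[mu]_(x in Omega) (g x * phi x)%:E)%E].

Definition H1_loc Omega f : Prop :=
  Lp_loc 2 Omega f /\
  forall j : 'I_n, exists2 g, is_weak_partial Omega j f g & Lp_loc 2 Omega g.

Definition is_weak_gradient (M : nat) Omega
    (u : 'rV[R]_n -> 'rV[R]_M) (Du : 'rV[R]_n -> 'M[R]_(n, M)) : Prop :=
  forall (j : 'I_n) (k : 'I_M),
    is_weak_partial Omega j (fun x => u x ord0 k) (fun x => Du x j k).

(* For x0 in an open set on which u is L^2_loc, the integral is finite for
   small r, and only such r matter for the limit. *)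
Definition vanishes_to_infinite_order (M : nat)
    (u : 'rV[R]_n -> 'rV[R]_M) (x0 : 'rV[R]_n) : Prop :=
  forall m : nat,
    ((r ^- m)%:E * \int[mu]_(x in eball x0 r) (enorm (u x) ^+ 2)%:E)%E
      @[r --> (0 : R)^'+] --> (0 : \bar R)%E.

End function_spaces.

(* Main.v *)
Require Import Defs.
From HB Require Import structures.
From mathcomp Require Import all_boot all_order all_algebra.
From mathcomp Require Import all_classical all_reals all_analysis.
From mathcomp Require Import measurable_realfun lra ring.
Import Order.TTheory GRing.Theory Num.Theory.
Import numFieldNormedType.Exports.

Set Implicit Arguments.
Unset Strict Implicit.
Unset Printing Implicit Defensive.

Local Open Scope classical_set_scope.
Local Open Scope ring_scope.

(** A function with weak gradient controlled by [V |u|] is, along almost every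
segment parallel to an axis, absolutely continuous, and Gronwall's inequality
there bounds [U = sum_k |u_k|] at one point by [2 ^ (1 + 2 int V)] times its
value at any other.  Hence [w = ln (1 + U / eps)] oscillates by at most
[1 + 2 int V] on such a segment, so that halving one side of a box costs
[int_B w <= 2 int_B' w + |B| + 2 l int_B V], where [l] is that side.  On a cube
of side [l], [l V <= 1 + (l V)^n] bounds the error by a multiple of the volume
that depends only on the [L^n] norm of [V]; this is where the exponent [n]
enters.  Iterating over [k] dyadic scales gives
[int_Q0 w <= 2^(n k) int_Qk w + k D], with [D] independent of [k] and [eps].
Take [eps = 2^(- N k)]: vanishing to infinite order keeps the first term
bounded, while [w >= N k ln 2 + ln d] where [U >= d].  Letting [k] and then [N]
tend to infinity, [{U >= d}] is negligible in [Q0].  Connectedness propagates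
this from one cube to the whole domain. *)

(** The logarithm is natural because the hypothesis bounds the gradient of [ln U] by a multiple of
    [V]; at zeros of [U], where this makes no sense, the multiplicative inequality on lines survives
    the addition of [eps]. Halving one side at a time keeps every comparison one-dimensional, so no
    Poincare or Sobolev inequality enters. The loss [2 ^+ n] per halved cube is exactly the inverse
    of the volume ratio: every scale adds the same error, which makes the total linear in [k]. The
    obstacle is to get from a weak gradient to lines. It is known only through smooth test
    functions, and [u] is only almost everywhere equal to a Borel function. Statements along lines
    are therefore made for almost every pair [(x, t)], comparing [x] with the point [upd i t x] of
    its line; this form is insensitive to null sets and avoids choosing a continuous representative
    on each line. The local step needs no smallness of the cube or of [V]: it works on any cube
    whose closure lies in the domain, which is what lets connectedness finish the proof. *)

(** * Integrals of functions that need not be measurable *)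

Section integral_extra.
Context d (T : measurableType d) (R : realType) (mu : {measure set T -> \bar R}).
Local Open Scope ereal_scope.

Import HBNNSimple.

Lemma ge0_integral_ereal_sup_nnsfun (f : T -> \bar R) : (forall x, 0 <= f x) ->
  \int[mu]_x f x = ereal_sup [set sintegral mu (h : T -> R) |
    h in [set h : {nnsfun T >-> R} | forall x, (h x)%:E <= f x]].
Proof. by move=> f0; rewrite ge0_integralTE. Qed.

(** The integral is a supremum over simple functions. One lying below [f] can be set to 0 on [N]
    without changing its integral, and then lies below [g]; measurability of [f] and [g] never
    enters. *)
Lemma ge0_integral_le_off_null (f g : T -> \bar R) (N : set T) :
  measurable N -> mu N = 0 -> (forall x, 0 <= f x) -> (forall x, 0 <= g x) ->
  (forall x, ~ N x -> f x <= g x) -> \int[mu]_x f x <= \int[mu]_x g x.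
Proof.
move=> mN N0 f0 g0 fg.
rewrite !ge0_integral_ereal_sup_nnsfun//; apply: ge_ereal_sup => _ [h /= hf <-].
apply: ereal_sup_ubound => /=.
exists (proj_nnsfun h (measurableC mN)).
  move=> x; rewrite -mrestrict patchE; case: ifPn => // /set_mem Nx.
  exact: le_trans (hf x) (fg x Nx).
have -> : sintegral mu (h : T -> R) = \int[mu]_(x in setT) (h x)%:E.
  by rewrite integral_nnsfun// patch_setT.
rewrite -mrestrict (ge0_negligible_integral mN)//; last 2 first.
- by apply/measurable_EFinP; exact: measurable_funP.
- by move=> x _; rewrite lee_fin; exact: fun_ge0.
by rewrite setTD integral_nnsfun//; exact: measurableC.
Qed.

(* The library's [ae_eq_integral] needs both functions to be measurable. *)
Lemma ae_eq_integral_nomeas (D : set T) (f g : T -> \bar R) :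
  ae_eq mu D f g -> \int[mu]_(x in D) f x = \int[mu]_(x in D) g x.
Proof.
move=> [N [mN N0 fgN]].
have E x : ~ N x -> (f \_ D) x = (g \_ D) x.
  move=> Nx; rewrite !patchE; case: ifPn => //; rewrite inE => Dx.
  by apply: contrapT => fgx; apply: Nx; apply: fgN => /= /(_ Dx).
rewrite integral_mkcond [RHS]integral_mkcond integralE [RHS]integralE.
congr (_ - _); apply/eqP; rewrite eq_le; apply/andP; split;
  apply: (ge0_integral_le_off_null mN N0) => // x Nx;
  by rewrite ?funeposE ?funenegE E.
Qed.

(** The sets over which [f] integrates to 0 form a Dynkin system: the vanishing total integral gives
    complements, integrability gives countable disjoint unions. It remains to test on a generating
    pi-system. *)
Lemma ae_eq0_generator (G : set (set T)) (D : set T) (f : T -> \bar R) :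
  @measurable _ T = <<s G >> -> setI_closed G -> measurable D ->
  mu.-integrable D f -> \int[mu]_(x in D) f x = 0 ->
  (forall A, G A -> \int[mu]_(x in A `&` D) f x = 0) ->
  ae_eq mu D f (cst 0).
Proof.
move=> mG IG mD intf f0 fG; apply: integral_ae_eq => // E ED mE.
rewrite integral0.
have H : forall S, <<s G >> S -> [set S | \int[mu]_(x in S `&` D) f x = 0] S.
  apply: (dynkin_induction mG IG) => /=.
  - by rewrite setTI.
  - by [].
  - move=> S mS HS.
    have UE : S `&` D `|` ~` S `&` D = D by rewrite -setIUl setUv setTI.
    have : \int[mu]_(x in D) f x = \int[mu]_(x in S `&` D) f x +
        \int[mu]_(x in ~` S `&` D) f x.
      rewrite -integral_setU ?UE//.
      + exact: measurableI.
      + by apply: measurableI => //; exact: measurableC.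
      + exact: measurable_int intf.
      + by apply/disj_setPS => x [[Sx _] [/(_ Sx)]].
    by rewrite f0 HS add0e.
  - move=> F mF tF HF; rewrite setI_bigcupl integral_bigcup//.
    + by rewrite eseries0.
    + exact: trivIset_setIr.
    + by move=> i; exact: measurableI.
    + by apply: integrableS intf => //; [
       apply: bigcup_measurable => i _; exact: measurableI|
       apply: bigcup_sub => i _ x []].
by rewrite -(H E)/= ?setIidl// -mG.
Qed.

End integral_extra.

(** * Lebesgue measure and exchange of one coordinate *)

Lemma preimage_g_sigma (T T' : Type) (S : set (set T)) (G : set (set T'))
    (f : T -> T') : sigma_algebra setT S ->
  (forall B, G B -> S (f @^-1` B)) -> forall B, <<s G >> B -> S (f @^-1` B).
Proof.
move=> [S0 SC SU] GS.
suff: <<s G >> `<=` [set B | S (f @^-1` B)] by [].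
apply: smallest_sub => //; split => [|B /= /SC|F /= SF].
- by rewrite /= preimage_set0.
- by rewrite !setTD.
- by rewrite preimage_bigcup; exact: SU.
Qed.

(* In the library [lebesgue_measure] lives on [measurableTypeR R], which is
   convertible to [R] but carries another display; the second factor of the
   products below is therefore [RR]. *)
Section boxes.
Context (R : realType) (n : nat).
Notation RR := (measurableTypeR R).
Implicit Types (A : 'I_n -> set R) (C : set RR).

Definition boxset A : set 'rV[R]_n := [set x | forall j, A j (x ord0 j)].

Lemma measurable_boxset A : (forall j, measurable (A j)) -> measurable (boxset A).
Proof. exact: measurable_row_box. Qed.

Lemma lebesgue_row_boxset A : (forall j, measurable (A j)) ->
  lebesgue_row R n (boxset A) = (\prod_(j < n) lebesgue_measure (A j))%E.
Proof. exact: lebesgue_row_box. Qed.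

(** [G] is a parameter because two pi-systems are used: all measurable sets to identify measures,
    and [rays] to test the line invariant. *)
Definition boxes (G : set (set RR)) : set (set ('rV[R]_n * RR)) :=
  [set S | exists A C, [/\ forall j, G (A j), G C & S = boxset A `*` C]].

Lemma setI_closed_boxes G : setI_closed G -> setI_closed (boxes G).
Proof.
move=> IG _ _ [A [C [mA mC ->]]] [A' [C' [mA' mC' ->]]].
exists (fun j => A j `&` A' j), (C `&` C'); split.
- by move=> j; exact: IG.
- exact: IG.
- apply/seteqP; split => -[x t] /=.
    by move=> [[Ax Ct] [A'x C't]]; split => // j; split.
  by move=> [Ax [Ct C't]]; split; split => // j; have [] := Ax j.
Qed.

(** Since [G] contains [setT], a cylinder over one coordinate is a box, and the cylinders generate
    the product sigma-algebra. *)
Lemma g_sigma_algebra_boxes (G : set (set RR)) : G setT ->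
  @measurable _ RR = <<s G >> ->
  @measurable _ ('rV[R]_n * RR)%type = <<s boxes G >>.
Proof.
move=> GT mG.
have sG : sigma_algebra setT <<s boxes G >> by exact: smallest_sigma_algebra.
have mGR (B : set RR) : G B -> measurable B.
  by rewrite mG => ?; exact: sub_sigma_algebra.
apply/seteqP; split; last first.
  apply: smallest_sub; first exact: sigma_algebra_measurable.
  move=> _ [A [C [mA mC ->]]]; apply: measurableX; last exact: mGR.
  by apply: measurable_boxset => j; exact: mGR.
have box1 A C : (forall j, G (A j)) -> G C -> <<s boxes G >> (boxset A `*` C).
  by move=> GA GC; apply: sub_sigma_algebra; exists A, C.
apply: smallest_sub => // S [[A mA <-]|[C mC <-]]; rewrite setTI.
  move: A mA; apply: (@preimage_g_sigma _ _ _ _ (@fst 'rV[R]_n RR) sG).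
  rewrite -bigcup_seq => _ [i _ [B mB <-]]; rewrite setTI -comp_preimage.
  have {}mB : <<s G >> B by rewrite -mG.
  move: B mB; apply: (preimage_g_sigma sG) => B GB.
  have := box1 (fun j => if j == i then B else setT) setT.
  rewrite (_ : boxset _ `*` _ = (row_coord i \o fst) @^-1` B).
    by apply => // j; case: ifP.
  apply/seteqP; split => -[x t] /=; first by move=> [/(_ i)]; rewrite eqxx.
  by move=> Bx; split => // j; case: eqP => // ->.
have {}mC : <<s G >> C by rewrite -mG.
move: C mC; apply: (preimage_g_sigma sG) => C GC.
have := box1 (fun=> setT) C (fun=> GT) GC.
by congr (<<s boxes G >> _); apply/seteqP; split => -[x t] /=; [case|].
Qed.

End boxes.

Section upd.
Context (R : realType) (n : nat).
Notation RR := (measurableTypeR R).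
Notation mu := (lebesgue_row R n).
Notation lam := (@lebesgue_measure R).
Implicit Types (i : 'I_n) (x : 'rV[R]_n) (t : R).

Definition upd i t x : 'rV[R]_n := \row_j (if j == i then t else x ord0 j).

(* [swapr i] preserves the product measure; it replaces Fubini's theorem in the
   coordinate [i], which the iterated product [lebesgue_row] only provides for
   the coordinate 0. *)
Definition swapr i (p : 'rV[R]_n * RR) : 'rV[R]_n * RR :=
  (upd i p.2 p.1, p.1 ord0 i).

Lemma updE i t x j : upd i t x ord0 j = if j == i then t else x ord0 j.
Proof. by rewrite mxE. Qed.

Lemma upd_id i x : upd i (x ord0 i) x = x.
Proof. by apply/rowP => j; rewrite updE; case: eqP => // ->. Qed.

Lemma upd_upd i s t x : upd i s (upd i t x) = upd i s x.
Proof. by apply/rowP => j; rewrite !updE; case: eqP. Qed.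

Lemma upd_coord i t x : upd i t x ord0 i = t.
Proof. by rewrite updE eqxx. Qed.

Lemma measurable_upd i :
  measurable_fun setT (fun p : 'rV[R]_n * R => upd i p.2 p.1).
Proof.
apply: measurable_fun_row => j.
case: (eqVneq j i) => ji.
- rewrite (_ : _ \o _ = snd); first exact: measurable_snd.
  by apply/funext => p; rewrite /row_coord /= updE ji eqxx.
- rewrite (_ : _ \o _ = row_coord j \o fst).
    by apply: measurableT_comp; [exact: measurable_row_coord|exact: measurable_fst].
  by apply/funext => p; rewrite /row_coord /= updE (negbTE ji).
Qed.

Lemma measurable_swapr i : measurable_fun setT (swapr i).
Proof.
apply: measurable_fun_pair; first exact: measurable_upd.
apply: (measurableT_comp (measurable_row_coord i)).
exact: measurable_fst.
Qed.

HB.instance Definition _ i :=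
  @isMeasurableFun.Build _ _ _ _ (swapr i) (measurable_swapr i).

Lemma boxset_upd i t x (A : 'I_n -> set R) :
  boxset A (upd i t x) <-> A i t /\ forall j, j != i -> A j (x ord0 j).
Proof.
split => [H|[At Ax] j].
  split => [|j ji]; first by have := H i; rewrite upd_coord.
  by have := H j; rewrite updE (negbTE ji).
by rewrite updE; case: eqVneq => [->//|]; exact: Ax.
Qed.

Lemma swapr_boxset i (A : 'I_n -> set R) C :
  swapr i @^-1` (boxset A `*` C) =
  boxset (fun j => if j == i then C else A j) `*` A i.
Proof.
apply/seteqP; split => -[x t] /=.
  move=> [/boxset_upd[At Ax] Ci]; split => // j /=.
  by case: eqVneq => [->//|]; exact: Ax.
move=> [H At]; split; last by have := H i; rewrite eqxx.
by apply/boxset_upd; split => // j ji; have := H j; rewrite (negbTE ji).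
Qed.

Lemma measure_swapr_boxset i (A : 'I_n -> set R) (C : set RR) :
  (forall j, measurable (A j)) -> measurable C ->
  (mu \x lam)%E (swapr i @^-1` (boxset A `*` C)) = (mu \x lam)%E (boxset A `*` C).
Proof.
move=> mA mC; have mB : forall j, measurable (if j == i then C else A j).
  by move=> j; case: ifP => _; [exact: mC|exact: mA].
rewrite swapr_boxset.
have E1 : (mu \x lam)%E (boxset (fun j => if j == i then C else A j) `*` A i) =
    (lebesgue_row R n (boxset (fun j => if j == i then C else A j)) * lam (A i))%E.
  exact: (product_measure1E mu lam (measurable_boxset mB) (mA i)).
have E2 : (mu \x lam)%E (boxset A `*` C) = (lebesgue_row R n (boxset A) * lam C)%E.
  exact: (product_measure1E mu lam (measurable_boxset mA) mC).
rewrite E1 E2 lebesgue_row_boxset; last exact: mB.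
rewrite lebesgue_row_boxset; last exact: mA.
rewrite (bigD1 i)//= eqxx [in RHS](bigD1 i)//=.
rewrite muleAC [RHS]muleAC [X in (X * _)%E = _]muleC; congr (_ * _)%E.
by apply: eq_bigr => j /negbTE ->.
Qed.

(** On a box both measures are the same product of side lengths in another order. Boxes form a
    generating pi-system, exhausted by cubes of finite measure, so the measures agree everywhere. *)
Lemma pushforward_swapr i S : measurable S ->
  pushforward (mu \x lam)%E (swapr i) S = (mu \x lam)%E S.
Proof.
pose I k : set RR := `[- k%:R, k%:R]%classic.
have mI k : measurable (I k) by exact: measurable_itv.
have mRR : @measurable _ RR = <<s @measurable _ RR >>.
  by rewrite sigma_algebra_id//; exact: sigma_algebra_measurable.
move: S.
have := @measure_unique _ R _ (@boxes R n measurable)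
  (fun k => boxset (fun=> I k) `*` I k) (@g_sigma_algebra_boxes R n _ measurableT mRR)
  (@setI_closed_boxes R n _ (@measurableI _ _)) _ _
  (pushforward (mu \x lam)%E (swapr i)) (mu \x lam)%E.
apply.
- by move=> k; exists (fun=> I k), (I k); split => [j||]; first exact: mI; first exact: mI.
- apply/seteqP; split => // -[x t] _.
  pose b := \sum_j `|x ord0 j| + `|t|.
  exists (Num.bound b) => //=.
  have bb : b < (Num.bound b)%:R.
    apply: archi_boundP; apply: addr_ge0 => //; exact: sumr_ge0.
  split => [j|]; rewrite /I /= in_itv /= -ler_norml; apply: le_trans (ltW bb).
    rewrite /b (bigD1 j)//= -addrA lerDl; apply: addr_ge0 => //; exact: sumr_ge0.
  by rewrite lerDr sumr_ge0.
- move=> _ [A [C [mA mC ->]]]; exact: measure_swapr_boxset.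
- move=> k; have lI : lam (I k) \is a fin_num.
    by rewrite /I lebesgue_measure_itv /=; case: ifP.
  rewrite [X in (X < _)%E](_ : _ =
      (mu \x lam)%E (boxset (fun=> I k) `*` I k)); last first.
    exact: (measure_swapr_boxset i (fun=> mI k) (mI k)).
  have -> : (mu \x lam)%E (boxset (fun=> I k) `*` I k) =
    (lebesgue_row R n (boxset (fun=> I k)) * lam (I k))%E.
    exact: (product_measure1E mu lam (measurable_boxset (fun=> mI k)) (mI k)).
  rewrite lebesgue_row_boxset//.
  by rewrite ltey_eq fin_numM//; apply: prode_fin_num => j _; exact: lI.
  by move=> _; exact: mI.
Qed.

End upd.

Section swap_integral.
Context (R : realType) (n : nat) (i : 'I_n).
Notation RR := (measurableTypeR R).
Notation mu := (lebesgue_row R n).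
Notation lam := (@lebesgue_measure R).
Notation nu := (mu \x lam)%E.
Local Open Scope ereal_scope.
Implicit Types (D : set ('rV[R]_n * RR)) (f : 'rV[R]_n * RR -> \bar R).

Lemma ge0_integral_swapr D f : measurable D -> measurable_fun D f ->
  (forall p, D p -> 0 <= f p) ->
  \int[nu]_(p in swapr i @^-1` D) f (swapr i p) = \int[nu]_(p in D) f p.
Proof.
move=> mD mf f0.
have := ge0_integral_pushforward (@measurable_swapr R n i) nu mD mf.
move=> <-; last by move=> p /set_mem; exact: f0.
by apply: eq_measure_integral => S mS _; exact: pushforward_swapr.
Qed.

Lemma measurable_preimage_swapr D : measurable D -> measurable (swapr i @^-1` D).
Proof.
by move=> mD; rewrite -[X in measurable X]setTI; exact: measurable_swapr.
Qed.

Lemma measurable_fun_swapr D f : measurable D -> measurable_fun D f ->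
  measurable_fun (swapr i @^-1` D) (f \o swapr i).
Proof.
move=> mD mf; apply: (measurable_comp mD _ mf) => //.
  by move=> _ [p Dp <-].
exact: measurable_funTS (@measurable_swapr R n i).
Qed.

Lemma integrable_swapr D f : measurable D -> nu.-integrable D f ->
  nu.-integrable (swapr i @^-1` D) (f \o swapr i).
Proof.
move=> mD /integrableP[mf foo]; apply/integrableP; split.
  exact: measurable_fun_swapr.
rewrite (ge0_integral_swapr (f := fun p => `|f p|))//.
exact: measurableT_comp.
Qed.

Lemma integral_swapr D f : measurable D -> nu.-integrable D f ->
  \int[nu]_(p in swapr i @^-1` D) f (swapr i p) = \int[nu]_(p in D) f p.
Proof.
move=> mD intf; have mf := measurable_int _ intf.
rewrite integralE [RHS]integralE; congr (_ - _).
- transitivity (\int[nu]_(p in swapr i @^-1` D) f^\+ (swapr i p)).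
    by apply: eq_integral => p _; rewrite !funeposE.
  by apply: ge0_integral_swapr => //; exact: measurable_funepos.
- transitivity (\int[nu]_(p in swapr i @^-1` D) f^\- (swapr i p)).
    by apply: eq_integral => p _; rewrite !funenegE.
  by apply: ge0_integral_swapr => //; exact: measurable_funeneg.
Qed.

Lemma ae_swapr (P : 'rV[R]_n * RR -> Prop) :
  {ae nu, forall p, P p} -> {ae nu, forall p, P (swapr i p)}.
Proof.
move=> [N [mN N0 PN]]; exists (swapr i @^-1` N); split.
- exact: measurable_preimage_swapr.
- by rewrite -N0; exact: pushforward_swapr.
- by move=> p /= /PN.
Qed.

Lemma ae_fst (P : 'rV[R]_n -> Prop) :
  {ae mu, forall x, P x} -> {ae nu, forall p, P p.1}.
Proof.
move=> [N [mN N0 PN]]; exists (N `*` setT); split.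
- exact: measurableX.
- have -> : nu (N `*` setT) = (mu N * lam setT)%E.
    exact: (product_measure1E mu lam mN measurableT).
  by rewrite N0 mul0e.
- by move=> p /= /PN.
Qed.

(** Since [swapr i] preserves null sets, a property true almost everywhere in space is true almost
    everywhere on almost every line. *)
Lemma ae_upd (P : 'rV[R]_n -> Prop) : {ae mu, forall x, P x} ->
  {ae nu, forall p : 'rV[R]_n * RR, P (upd i p.2 p.1)}.
Proof. by move/ae_fst/ae_swapr. Qed.

Lemma ae_prod (P : 'rV[R]_n * RR -> Prop) : {ae nu, forall p, P p} ->
  {ae mu, forall x, {ae lam, forall t, P (x, t)}}.
Proof.
move=> [N [mN N0 PN]].
have : ae_eq mu setT (lam \o xsection N) (cst 0).
  apply/(ae_eq_integral_abs mu measurableT (measurable_fun_xsection lam mN)).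
  rewrite -N0; apply: eq_integral => x _.
  by rewrite gee0_abs.
apply: filterS => x /(_ Logic.I) /= Nx0; exists (xsection N x); split => //.
  exact: measurable_xsection.
by move=> t /= Pt; apply/xsectionP; exact: PN.
Qed.

End swap_integral.

(** * Smooth bumps and product test functions *)

Section smooth1.
Context {R : realType}.
Implicit Types (f g : R -> R) (k : nat).

(** The derivative is quantified existentially, so that closure properties supply it by hand and
    never have to compute [derive1]. *)
Fixpoint Ck k f : Prop :=
  if k is k'.+1 then exists2 g : R -> R, (forall x : R, is_derive x (1 : R) f (g x)) & Ck k' g
  else True.

Definition smooth1 f := forall k, Ck k f.

Lemma CkS k f : Ck k.+1 f -> Ck k f.
Proof.
elim: k f => // k IH f [g fg Cg]; exists g => //; exact: IH.
Qed.

Lemma Ck_cst k (c : R) : Ck k (cst c).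
Proof.
elim: k c => // k IH c; exists (cst 0) => // x; exact: is_derive_cst.
Qed.

Lemma CkD k f g : Ck k f -> Ck k g -> Ck k (f \+ g).
Proof.
elim: k f g => // k IH f g [f' ff' Cf] [g' gg' Cg]; exists (f' \+ g').
  by move=> x; exact: is_deriveD.
exact: IH.
Qed.

Lemma CkM k f g : Ck k f -> Ck k g -> Ck k (f \* g).
Proof.
elim: k f g => // k IH f g Cf Cg.
have {}Cf' := CkS Cf; have {}Cg' := CkS Cg.
case: Cf => f' ff' Cf; case: Cg => g' gg' Cg; exists (f \* g' \+ g \* f').
  by move=> x; apply: is_deriveM.
by apply: CkD; exact: IH.
Qed.

Lemma Ck_affine k f (a b : R) : Ck k f -> Ck k (fun x => f (a * x + b)).
Proof.
elim: k f => // k IH f [f' ff' Cf]; exists (fun x => f' (a * x + b) * a).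
  move=> x.
  have aff : is_derive x (1 : R) (fun x => a * x + b) a.
    have -> : (fun x => a * x + b) = a *: id + cst b :> (R -> R) by apply/funext.
    by apply: is_derive_eq; rewrite addr0 [LHS]mulr1.
  exact: (is_derive1_comp (ff' _)).
by apply: (@CkM k _ (cst a)); [exact: IH|exact: Ck_cst].
Qed.

Lemma smooth1_derive f : smooth1 f ->
  (forall x : R, is_derive x (1 : R) f (derive1 f x)) /\ smooth1 (derive1 f).
Proof.
move=> sf; have E g : (forall x : R, is_derive x (1 : R) f (g x)) -> g = derive1 f.
  by move=> fg; apply/funext => x; rewrite derive1E; have [_ ->] := fg x.
split => [x|k].
  by have [g fg _] := sf 1%N; rewrite -(E g fg).
by have [g fg] := sf k.+1; rewrite (E g fg).
Qed.

Lemma smooth1_primitive f g :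
  smooth1 g -> (forall x : R, is_derive x (1 : R) f (g x)) -> smooth1 f.
Proof. by move=> sg fg [|k] //; exists g. Qed.

Lemma smooth1_continuous f : smooth1 f -> continuous f.
Proof.
move=> /smooth1_derive[df _] x; have [dfx _] := df x.
by apply: differentiable_continuous; exact/derivable1_diffP.
Qed.

(** This is the [n]-th power of [y / n <= expR (y / n)]. *)
Lemma exprn_le_expR (n : nat) (y : R) : 0 <= y -> y ^+ n <= n%:R ^+ n * expR y.
Proof.
case: n => [|n] y0; first by rewrite !expr0 mul1r -expR0 ler_expR.
have n0 : (0 : R) < n.+1%:R by rewrite ltr0n.
have -> : y = n.+1%:R * (y / n.+1%:R) by rewrite mulrC divfK// gt_eqF.
rewrite exprMn ler_pM2l ?exprn_gt0// expRM_natl.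
apply: lerXn2r; rewrite ?nnegrE ?expR_ge0 ?divr_ge0//.
by apply: le_trans (expR_ge1Dx _); rewrite lerDr.
Qed.

Lemma poly_expR_bounded (p : {poly R}) : exists2 C : R, 0 <= C &
  forall y, 0 <= y -> `|p.[y]| * expR (- y) <= C.
Proof.
exists (\sum_(i < size p) `|p`_i| * i%:R ^+ i).
  by apply: sumr_ge0 => i _; rewrite mulr_ge0 ?exprn_ge0.
move=> y y0; rewrite horner_coef.
apply: (@le_trans _ _ (\sum_(i < size p) `|p`_i| * y ^+ i * expR (- y))).
  rewrite -mulr_suml ler_wpM2r ?expR_ge0//.
  apply: le_trans (ler_norm_sum _ _ _) _; apply: ler_sum => i _.
  by rewrite normrM (ger0_norm (exprn_ge0 _ y0)).
apply: ler_sum => i _; rewrite -mulrA ler_wpM2l// expRN ler_pdivrMr ?expR_gt0//.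
exact: exprn_le_expR.
Qed.

(* The family is closed under derivation, see [is_derive_flat]; this is how
   [exp (- 1 / x)] is shown to be smooth at 0. *)
Definition flat (p : {poly R}) (x : R) : R :=
  if 0 < x then p.[x^-1] * expR (- x^-1) else 0.

(** For positive [x], the value is [x ^+ 2] times that of the member of the family with polynomial
    [p * 'X^2], which is bounded. A quadratic bound forces the derivative at 0 to be 0. *)
Lemma flat_quadratic (p : {poly R}) : exists2 C : R, 0 <= C &
  forall x, `|flat p x| <= C * x ^+ 2.
Proof.
have [C C0 HC] := poly_expR_bounded (p * 'X^2).
exists C => // x; rewrite /flat; case: ifPn => x0; last first.
  by rewrite normr0 mulr_ge0// sqr_ge0.
have := HC x^-1; rewrite invr_ge0 (ltW x0) => /(_ isT).
rewrite hornerM hornerXn normrM (@ger0_norm _ (x^-1 ^+ 2)); last first.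
  by rewrite exprn_ge0// invr_ge0 ltW.
rewrite normrM (ger0_norm (expR_ge0 _)) mulrAC exprVn.
by rewrite ler_pdivrMr// exprn_gt0.
Qed.

Lemma is_derive_flat (p : {poly R}) (x : R) :
  is_derive x (1 : R) (flat p) (flat ('X^2 * (p - p^`())) x).
Proof.
have [x0|x0|->] := ltgtP x 0.
- have -> : flat ('X^2 * (p - p^`())) x = 0 by rewrite /flat ltNge (ltW x0).
  apply: (@near_eq_is_derive _ _ _ (cst 0)).
  near=> y; rewrite /flat ltNge ltW//=; near: y; exact: lt_nbhsl.
- rewrite [X in is_derive _ _ _ X]/flat x0.
  have xn0 : x != 0 by rewrite gt_eqF.
  have dV : is_derive x (1 : R) (fun y : R => y^-1) (- x ^- 2).
    have := @is_deriveV R id x 1 1 xn0 (is_derive_id x 1).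
    by move=> H; apply: (is_derive_eq H); rewrite /GRing.scale /= mulr1.
  have dp : is_derive x (1 : R) (fun y => p.[y^-1]) (p^`().[x^-1] * - x ^- 2).
    exact: (@is_derive1_comp _ (horner p) (fun y => y^-1)).
  have dN : is_derive x (1 : R) (fun y : R => - y^-1) (- - x ^- 2).
    exact: is_deriveN.
  have de : is_derive x (1 : R) (fun y : R => expR (- y^-1))
      (expR (- x^-1) * - - x ^- 2).
    exact: (@is_derive1_comp _ expR (fun y => - y^-1)).
  have dF : is_derive x (1 : R) (fun y => p.[y^-1] * expR (- y^-1))
      (('X^2 * (p - p^`())).[x^-1] * expR (- x^-1)).
    apply: (is_derive_eq (is_deriveM dp de)).
    by rewrite !hornerE -!exprVn /GRing.scale /=; ring.
  apply: near_eq_is_derive dF; near=> y; rewrite /flat ifT//; near: y.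
  exact: lt_nbhsr.
- have -> : flat ('X^2 * (p - p^`())) 0 = 0 by rewrite /flat ltxx.
  have f0 : flat p 0 = 0 by rewrite /flat ltxx.
  suff H : (fun h => h^-1 *: (flat p (h *: 1 + 0) - flat p 0)) @ 0^' --> (0 : R).
    by apply: DeriveDef; [apply/cvg_ex; exists 0|exact: cvg_lim].
  (* The difference quotient at 0 is at most [C] times the modulus of [h]; dividing by [C + 1] below
     avoids the case [C = 0]. *)
  have [C C0 HC] := flat_quadratic p.
  apply/cvgr0Pnorm_le => e e0; near=> h.
  have h0 : h != 0 by near: h; exact: nbhs_dnbhs_neq.
  rewrite f0 subr0 addr0 [h *: 1]mulr1 normrZ normfV ler_pdivrMl ?normr_gt0//.
  apply: (le_trans (HC h)); rewrite -(@real_normK _ h) ?num_real// expr2 mulrCA.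
  rewrite ler_wpM2l//.
  have : `|h| <= e / (C + 1).
    near: h; apply: dnbhs0_le.
    by rewrite divr_gt0// ltr_wpDl.
  rewrite ler_pdivlMr ?ltr_wpDl// => He; apply: le_trans He.
  by rewrite mulrC ler_wpM2l// lerDl.
Unshelve. all: by end_near. Qed.

Lemma smooth1_flat (p : {poly R}) : smooth1 (flat p).
Proof.
move=> k; elim: k p => // k IH p.
exists (flat ('X^2 * (p - p^`()))); last exact: IH.
exact: is_derive_flat.
Qed.

End smooth1.

(** * Rays, bumps and primitives on the real line *)

Section rays.
Context (R : realType).
Notation RR := (measurableTypeR R).

(* Rays form a pi-system whose traces on a bounded interval are intervals, so
   that their indicators are limits of bumps. *)
Definition rays : set (set RR) := [set A | A = setT \/ exists c : R, A = `]c, +oo[%classic].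

Lemma rays_setT : rays setT. Proof. by left. Qed.

Lemma setI_closed_rays : setI_closed rays.
Proof.
move=> _ _ [->|[c ->]] [->|[d ->]]; rewrite ?setIT ?setTI; [by left|right..].
- by exists d.
- by exists c.
- exists (Num.max c d); apply/seteqP; split => x /=; rewrite !in_itv /= !andbT.
    by move=> [cx dx]; rewrite gt_max cx.
  by rewrite gt_max => /andP.
Qed.

Lemma g_sigma_algebra_rays : @measurable _ RR = <<s rays >>.
Proof.
apply/seteqP; split; last first.
  apply: smallest_sub; first exact: sigma_algebra_measurable.
  move=> _ [->|[c ->]]; first exact: measurableT.
  exact: measurable_itv.
have -> : @measurable _ RR = <<s @RGenOInfty.G R >>.
  exact: RGenOInfty.measurableE.
by apply: sub_sigma_algebra2 => _ [c ->]; right; exists c.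
Qed.

End rays.

Section bump.
Context {R : realType}.
Implicit Types (c d x y : R) (m : nat).

Lemma flat1_le1 y : 0 <= flat 1 y <= 1.
Proof.
rewrite /flat; case: ifPn => y0; last by rewrite lexx ler01.
by rewrite hornerC mul1r expR_ge0 -expR0 ler_expR oppr_le0 invr_ge0 ltW.
Qed.

(** Dilating by [m.+1] drives [flat 1] to the indicator of the positive half-line. The bumps thus
    tend pointwise to the indicator of []c, d[] while staying in [[0, 1]], as dominated convergence
    wants. *)
Definition bump c d m x : R := flat 1 (m.+1%:R * (x - c)) * flat 1 (m.+1%:R * (d - x)).

Lemma smooth1_bump c d m : smooth1 (bump c d m).
Proof.
move=> k; rewrite (_ : bump c d m = (fun x => flat 1 (m.+1%:R * x + - (m.+1%:R * c))) \*
   (fun x => flat 1 (- m.+1%:R * x + m.+1%:R * d))); last first.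
  by apply/funext => x; rewrite /bump /=; congr (flat _ _ * flat _ _); ring.
by apply: CkM; apply: Ck_affine; exact: smooth1_flat.
Qed.

Lemma bump_le1 c d m x : 0 <= bump c d m x <= 1.
Proof.
have /andP[a0 a1] := flat1_le1 (m.+1%:R * (x - c)).
have /andP[b0 b1] := flat1_le1 (m.+1%:R * (d - x)).
by rewrite /bump mulr_ge0// mulr_ile1.
Qed.

Lemma bump_eq0 c d m x : x \notin `]c, d[ -> bump c d m x = 0.
Proof.
rewrite in_itv /= negb_and -!leNgt /bump /flat => /orP[xc|dx].
- by rewrite ifF ?mul0r// ltNge pmulr_rle0// subr_le0 xc.
- by rewrite [X in _ * X]ifF ?mulr0// ltNge pmulr_rle0// subr_le0 dx.
Qed.

Lemma cvg_flat1 y : 0 < y -> (flat 1 (m.+1%:R * y)) @[m --> \oo] --> (1 : R).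
Proof.
move=> y0; rewrite (_ : (fun m => _) = (fun m : nat => expR (- (y^-1 * m.+1%:R^-1)))).
  rewrite -[X in _ --> X]expR0 -oppr0 -(mulr0 y^-1).
  apply: continuous_cvg; first exact: continuous_expR.
  apply: cvgN; apply: cvgMr; exact: cvg_harmonic.
apply/funext => m; rewrite /flat ifT; last by rewrite mulr_gt0.
by rewrite hornerC mul1r invfM mulrC.
Qed.

Lemma cvg_bump c d x : bump c d m x @[m --> \oo] --> (\1_(`]c, d[%classic) x : R).
Proof.
rewrite indicE; case: (boolP (x \in `]c, d[)) => xcd; last first.
  rewrite memNset; last by apply/negP.
  by under eq_fun do rewrite bump_eq0//; exact: cvg_cst.
rewrite mem_set//=; move: xcd; rewrite in_itv /= => /andP[cx xd].
rewrite -[X in _ --> X]mulr1.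
by apply: cvgM; apply: cvg_flat1; rewrite subr_gt0.
Qed.

End bump.

Section primitive.
Context {R : realType}.
Notation lam := (@lebesgue_measure R).

Definition primitive (f : R -> R) (x : R) : R := \int[lam]_(t in `]-oo, x]) f t.

Lemma smooth1_primitiveE (f : R -> R) : smooth1 f ->
  lam.-integrable setT (EFin \o f) ->
  smooth1 (primitive f) /\ forall x, is_derive x (1 : R) (primitive f) (f x).
Proof.
move=> sf intf.
have df x : is_derive x (1 : R) (primitive f) (f x).
  have [] := @continuous_FTC1 _ f -oo%O x (x + 1) _ _ _ _.
  - by rewrite ltrDl.
  - by apply: integrableS intf => //; exact: measurable_itv.
  - by rewrite ltNyr.
  - exact: smooth1_continuous.
  by move=> dx; rewrite derive1E => <-; exact: DeriveDef.
split => //; exact: smooth1_primitive df.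
Qed.

(** To the right of [b] the primitive is the whole integral of [f]. Hence the primitive of a kernel
    of mean zero can again be a factor of a test function. *)
Lemma primitive_eq0 (f : R -> R) (a b x : R) :
  (forall t, t \notin `]a, b[ -> f t = 0) -> \int[lam]_t f t = 0 ->
  x \notin `]a, b[ -> primitive f x = 0.
Proof.
move=> f0 intf0; rewrite in_itv /= negb_and -!leNgt => /orP[xa|bx].
  rewrite /primitive /Rintegral integral0_eq// => t; rewrite /= in_itv /= => tx.
  by rewrite f0// in_itv /= negb_and -!leNgt (le_trans tx xa).
rewrite -intf0 [RHS]Rintegral_mkcond /primitive Rintegral_mkcond.
apply: eq_Rintegral => t _; rewrite patch_setT patchE; case: ifPn => //.
rewrite notin_setE /= in_itv /= => /negP; rewrite -ltNge => xt.
by rewrite f0// in_itv /= negb_and -!leNgt (ltW (le_lt_trans bx xt)) orbT.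
Qed.

End primitive.

(** * Products of one-variable functions as test functions *)

Section product_functions.
Context {R : realType} {n : nat}.
Implicit Types (rho : 'I_n -> R -> R) (a b : 'I_n -> R).

Definition prodf rho (x : 'rV[R]_n) : R := \prod_j rho j (x ord0 j).

Definition setf rho (i : 'I_n) (f : R -> R) : 'I_n -> R -> R :=
  fun j => if j == i then f else rho j.

Lemma prodf_setf rho i f x :
  prodf (setf rho i f) x = f (x ord0 i) * \prod_(j | j != i) rho j (x ord0 j).
Proof.
rewrite /prodf (bigD1 i)//= {1}/setf eqxx; congr (_ * _).
by apply: eq_bigr => j /negbTE ji; rewrite /setf ji.
Qed.

Lemma prodf_upd rho i t x :
  prodf rho (upd i t x) = rho i t * \prod_(j | j != i) rho j (x ord0 j).
Proof.
rewrite /prodf (bigD1 i)//= upd_coord; congr (_ * _).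
by apply: eq_bigr => j /negbTE ji; rewrite updE ji.
Qed.

Lemma is_derive_prodf rho i x : (forall j, smooth1 (rho j)) ->
  is_derive x (delta_mx ord0 i) (prodf rho)
    (prodf (setf rho i (derive1 (rho i))) x).
Proof.
move=> srho; have [drho _] := smooth1_derive (srho i).
have [/cvg_ex[l hl] hd] := drho (x ord0 i).
pose P := \prod_(j | j != i) rho j (x ord0 j).
have E : (fun h : R => h^-1 *: (prodf rho (h *: delta_mx ord0 i + x) - prodf rho x)) =
  (fun h => P * (h^-1 *: (rho i (h *: 1 + x ord0 i) - rho i (x ord0 i)))).
  apply/funext => h.
  have -> : h *: delta_mx ord0 i + x = upd i (h + x ord0 i) x.
    apply/rowP => j; rewrite updE !mxE eqxx /=.
    by case: eqVneq => [->|_]; rewrite ?mulr1// mulr0 add0r.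
  rewrite prodf_upd -[in prodf rho x](upd_id i x) prodf_upd -/P -mulrBl.
  by rewrite [h *: 1]mulr1 /GRing.scale /= mulrA mulrC.
have H : (fun h : R => h^-1 *: (prodf rho (h *: delta_mx ord0 i + x) - prodf rho x))
    @ 0^' --> P * l.
  by rewrite E; apply: cvgMr.
apply: DeriveDef; first by apply/cvg_ex; exists (P * l).
rewrite prodf_setf -/P mulrC -hd.
by rewrite /derive (cvg_lim _ H)// (cvg_lim _ hl).
Qed.

Lemma partial_prodf rho i : (forall j, smooth1 (rho j)) ->
  partial i (prodf rho) = prodf (setf rho i (derive1 (rho i))).
Proof.
by move=> srho; apply/funext => x; rewrite /partial; have [_ ->] := is_derive_prodf i x srho.
Qed.

Lemma smooth1_setf rho i f : (forall j, smooth1 (rho j)) -> smooth1 f ->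
  forall j, smooth1 (setf rho i f j).
Proof. by move=> srho sf j; rewrite /setf; case: ifP. Qed.

Lemma continuous_prodf rho : (forall j, continuous (rho j)) -> continuous (prodf rho).
Proof.
move=> crho; apply: continuous_big => [y|j _ x]; first exact: mul_continuous.
apply: (@continuous_comp _ _ _ (fun x : 'rV[R]_n => x ord0 j)).
  exact: coord_continuous.
exact: crho.
Qed.

(** A partial derivative of such a product is another such product, with one factor differentiated;
    this class is thus stable under iteration. *)
Lemma smooth_prodf rho : (forall j, smooth1 (rho j)) -> smooth (prodf rho).
Proof.
move=> srho s; suff [rho' srho' ->] : exists2 rho', forall j, smooth1 (rho' j) &
    foldr (@partial R n) (prodf rho) s = prodf rho'.
  split => [|x j]; first by apply: continuous_prodf => j; exact: smooth1_continuous.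
  by have [] := is_derive_prodf j x srho'.
elim: s => [|i s [rho' srho' /= ->]]; first by exists rho.
exists (setf rho' i (derive1 (rho' i))); last exact: partial_prodf.
by apply: smooth1_setf => //; have [] := smooth1_derive (srho' i).
Qed.

Definition cbox a b : set 'rV[R]_n := boxset (fun j => `[a j, b j]%classic).
Definition obox a b : set 'rV[R]_n := boxset (fun j => `]a j, b j[%classic).

Lemma compact_cbox a b : compact (cbox a b).
Proof. by apply: rV_compact => j; exact: segment_compact. Qed.

Lemma closed_cbox a b : closed (cbox a b).
Proof. by apply: compact_closed; [exact: norm_hausdorff|exact: compact_cbox]. Qed.

Lemma measurable_cbox a b : measurable (cbox a b).
Proof. by apply: measurable_boxset => j; exact: measurable_itv. Qed.

Lemma measurable_obox a b : measurable (obox a b).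
Proof. by apply: measurable_boxset => j; exact: measurable_itv. Qed.

Lemma obox_cbox a b : obox a b `<=` cbox a b.
Proof. by move=> x xab j; apply: subset_itv_oo_cc; exact: xab. Qed.

Lemma prodf_eq0 rho a b x : (forall j t, t \notin `]a j, b j[ -> rho j t = 0) ->
  ~ obox a b x -> prodf rho x = 0.
Proof.
move=> rho0 /existsNP[j /negP xj].
by rewrite /prodf (bigD1 j)//= rho0 ?mul0r.
Qed.

Lemma test_function_prodf Omega rho a b : (forall j, smooth1 (rho j)) ->
  (forall j t, t \notin `]a j, b j[ -> rho j t = 0) ->
  cbox a b `<=` Omega -> test_function Omega (prodf rho).
Proof.
move=> srho rho0 abO.
have S : closure [set x | prodf rho x != 0] `<=` cbox a b.
  have /closure_id -> := @closed_cbox a b; apply: closureS => x /= /eqP px.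
  apply: obox_cbox; apply: contrapT => xab.
  by apply: px; exact: prodf_eq0 xab.
split; first exact: smooth_prodf.
- by apply: (subclosed_compact _ (@compact_cbox a b)) => //; exact: closed_closure.
- exact: subset_trans abO.
Qed.

Lemma measurable_prodf rho : (forall j, continuous (rho j)) ->
  measurable_fun setT (prodf rho).
Proof.
move=> crho; apply: measurable_prod => j _.
apply: (measurableT_comp _ (measurable_row_coord j)).
exact: continuous_measurable_fun.
Qed.

End product_functions.

(** * Fubini and Tonelli on rectangles *)

Section integral_rectangle.
Context d1 d2 (T1 : measurableType d1) (T2 : measurableType d2) (R : realType).
Variables (m1 : {sigma_finite_measure set T1 -> \bar R}).
Variables (m2 : {sigma_finite_measure set T2 -> \bar R}).
Variables (D : set T1) (C : set T2) (mD : measurable D) (mC : measurable C).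
Local Open Scope ereal_scope.
Implicit Types F : T1 * T2 -> \bar R.

Let mX : measurable (D `*` C). Proof. exact: measurableX. Qed.

Let patchX F x y :
  (F \_ (D `*` C)) (x, y) = ((fun x => ((fun y => F (x, y)) \_ C) y) \_ D) x.
Proof. by rewrite !patchE in_setX; do 2 case: (_ \in _). Qed.

Let integral_patchX F x : \int[m2]_y (F \_ (D `*` C)) (x, y) =
  ((fun x => \int[m2]_(y in C) F (x, y)) \_ D) x.
Proof.
under eq_integral do rewrite patchX.
rewrite [in RHS]patchE; case: ifPn => xD.
  by rewrite [RHS]integral_mkcond; apply: eq_integral => y _; rewrite patchE xD.
by rewrite integral0_eq// => y _; rewrite patchE (negbTE xD).
Qed.

Lemma ge0_integral_rectangle F : measurable_fun (D `*` C) F ->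
  (forall p, (D `*` C) p -> 0 <= F p) ->
  \int[m1 \x m2]_(p in D `*` C) F p = \int[m1]_(x in D) \int[m2]_(y in C) F (x, y).
Proof.
move=> mF F0; rewrite integral_mkcond fubini_tonelli1//; last 2 first.
- exact/(measurable_restrictT _ mX).
- by move=> p; rewrite patchE; case: ifPn => // /set_mem/F0.
by rewrite [RHS]integral_mkcond; apply: eq_integral => x _; exact: integral_patchX.
Qed.

Lemma integral_rectangle F : (m1 \x m2).-integrable (D `*` C) F ->
  \int[m1 \x m2]_(p in D `*` C) F p = \int[m1]_(x in D) \int[m2]_(y in C) F (x, y).
Proof.
move=> /(integrable_mkcond _ mX) intF; rewrite integral_mkcond.
rewrite -integral12_prod_meas1// [RHS]integral_mkcond.
by apply: eq_integral => x _; exact: integral_patchX.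
Qed.

Lemma ae_integrable_rectangle F : (m1 \x m2).-integrable (D `*` C) F ->
  {ae m1, forall x, D x -> m2.-integrable C (fun y => F (x, y))}.
Proof.
move=> /(integrable_mkcond _ mX) /ae_integrable1.
apply: filterS => x H Dx; apply/(integrable_mkcond _ mC).
by apply: eq_integrable H => // y _; rewrite patchX patchE mem_set.
Qed.

Lemma measurable_integral_rectangle F : (m1 \x m2).-integrable (D `*` C) F ->
  measurable_fun D (fun x => \int[m2]_(y in C) F (x, y)).
Proof.
move=> /(integrable_mkcond _ mX) intF.
apply/(measurable_restrictT _ mD).
have := measurable_fubini_F intF; apply: eq_measurable_fun => x _.
exact: integral_patchX.
Qed.

Lemma integrable_integral_rectangle F : (m1 \x m2).-integrable (D `*` C) F ->
  m1.-integrable D (fun x => \int[m2]_(y in C) F (x, y)).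
Proof.
move=> /(integrable_mkcond _ mX) intF.
apply/(integrable_mkcond _ mD).
have := integrable_fubini_F intF; apply: eq_integrable => // x _.
exact: integral_patchX.
Qed.

Lemma ge0_integral_fst (f : T1 -> \bar R) : measurable_fun D f ->
  (forall x, D x -> 0 <= f x) ->
  \int[m1 \x m2]_(p in D `*` C) f p.1 = (\int[m1]_(x in D) f x) * m2 C.
Proof.
move=> mf f0; rewrite ge0_integral_rectangle//; last 2 first.
- apply: (measurable_comp mD _ mf); first by move=> _ [p [Dp _] <-].
  by apply: measurable_funTS; exact: measurable_fst.
- by move=> p [Dp _]; exact: f0.
rewrite -ge0_integralZr//; apply: eq_integral => x _ /=.
by rewrite -[RHS]integral_cst.
Qed.

Lemma integrable_fst (f : T1 -> \bar R) : m2 C < +oo ->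
  m1.-integrable D f -> (m1 \x m2).-integrable (D `*` C) (f \o fst).
Proof.
move=> Coo /integrableP[mf foo]; apply/integrableP; split.
  apply: (measurable_comp mD _ mf); first by move=> _ [p [Dp _] <-].
  by apply: measurable_funTS; exact: measurable_fst.
rewrite (ge0_integral_fst (f := fun x => `|f x|))//.
  by apply: lte_mul_pinfty => //; [exact: integral_ge0|rewrite ge0_fin_numE// integral_ge0].
exact: measurableT_comp.
Qed.

End integral_rectangle.

Lemma integrable_mul_bounded d (T : measurableType d) (R : realType)
    (mu : {measure set T -> \bar R}) (D : set T) (f g : T -> R) (c : R) :
  measurable D -> mu.-integrable D (EFin \o f) -> measurable_fun D g ->
  (forall x, D x -> `|g x| <= c) -> mu.-integrable D (fun x => (f x * g x)%:E).
Proof.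
move=> mD intf mg gc.
have mf : measurable_fun D f by apply/measurable_EFinP; exact: measurable_int intf.
apply: (le_integrable mD _ _ (integrableZl mD c intf)).
  by apply/measurable_EFinP; exact: measurable_funM.
move=> x Dx; rewrite /= lee_fin !normrM mulrC ler_wpM2r//.
by apply: le_trans (gc x Dx) _; exact: ler_norm.
Qed.

(** * Absolute continuity on lines *)

Lemma smooth1_lin {R : realType} (c d : R) (f g : R -> R) : smooth1 f -> smooth1 g ->
  smooth1 (fun t => c * f t + d * g t).
Proof.
move=> sf sg k; apply: (@CkD _ k (cst c \* f) (cst d \* g)); apply: CkM => //.
- exact: Ck_cst.
- exact: Ck_cst.
Qed.

Lemma prodf_setf_upd {R : realType} {n : nat} (rho : 'I_n -> R -> R) i k t x :
  prodf (setf rho i k) (upd i t x) = k t * \prod_(j | j != i) rho j (x ord0 j).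
Proof.
rewrite prodf_setf upd_coord; congr (_ * _).
by apply: eq_bigr => j /negbTE ji; rewrite updE ji.
Qed.

Section lines.
Context (R : realType) (n : nat) (i : 'I_n) (a b : 'I_n -> R).
Notation RR := (measurableTypeR R).
Notation mu := (lebesgue_row R n).
Notation lam := (@lebesgue_measure R).
Notation nu := (mu \x lam)%E.
Notation O := (obox a b).
Notation I := (`]a i, b i[%classic : set RR).
Implicit Types rho : 'I_n -> R -> R.

Lemma measurable_side : measurable I. Proof. exact: measurable_itv. Qed.

Lemma lebesgue_side_lty : (lam I < +oo)%E.
Proof. by rewrite lebesgue_measure_itv /=; case: ifP => _; rewrite ltry. Qed.

Lemma measurable_obox_side : measurable (O `*` I : set ('rV[R]_n * RR)).
Proof. apply: measurableX; [exact: measurable_obox|exact: measurable_side]. Qed.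

Lemma swapr_obox : swapr i @^-1` (O `*` I) = O `*` I.
Proof.
rewrite swapr_boxset; congr (_ `*` _).
by apply/seteqP; split => x /= H j; have := H j; case: eqVneq => // ->.
Qed.

Lemma integrable_obox_fst (f : 'rV[R]_n -> R) : mu.-integrable O (EFin \o f) ->
  nu.-integrable (O `*` I) (fun p => (f p.1)%:E).
Proof.
exact: (integrable_fst (measurable_obox a b) measurable_side lebesgue_side_lty).
Qed.

Lemma integrable_obox_upd (f : 'rV[R]_n -> R) : mu.-integrable O (EFin \o f) ->
  nu.-integrable (O `*` I) (fun p => (f (upd i p.2 p.1))%:E).
Proof.
move=> /integrable_obox_fst /(integrable_swapr i measurable_obox_side).
by rewrite swapr_obox.
Qed.

Lemma integral_obox_swapr (F : 'rV[R]_n * RR -> \bar R) :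
  nu.-integrable (O `*` I) F ->
  (\int[nu]_(p in O `*` I) F (swapr i p) = \int[nu]_(p in O `*` I) F p)%E.
Proof.
by move=> /(integral_swapr i measurable_obox_side); rewrite swapr_obox.
Qed.

(* The indicator of [x_i <= s]. *)
Definition after (x : 'rV[R]_n) (s : R) : R := \1_(`[0, +oo[%classic : set R) (s - x ord0 i).

Lemma measurable_after : measurable_fun setT (fun p : 'rV[R]_n * RR => after p.1 p.2).
Proof.
have mB : measurable_fun setT (fun p : 'rV[R]_n * RR => (p.2 : R) - p.1 ord0 i).
  apply: measurable_funB; first exact: measurable_snd.
  by apply: (measurableT_comp (measurable_row_coord i)); exact: measurable_fst.
have mi : measurable_fun setT (\1_(`[0, +oo[%classic : set R) : R -> R).
  by apply: measurable_indic; exact: measurable_itv.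
exact: (measurableT_comp mi mB).
Qed.

Lemma after_le1 x s : `|after x s| <= 1.
Proof. by rewrite /after indicE; case: (_ \in _); rewrite ?normr1 ?normr0. Qed.

Section antiderivative.
Variables (f g : 'rV[R]_n -> R).
Hypotheses (intf : mu.-integrable O (EFin \o f)) (intg : mu.-integrable O (EFin \o g)).

Lemma integrable_tail :
  nu.-integrable (O `*` I) (fun p => (g (upd i p.2 p.1) * after p.1 p.2)%:E).
Proof.
apply: (integrable_mul_bounded (c := 1) measurable_obox_side).
- exact: integrable_obox_upd intg.
- exact: measurable_funTS measurable_after.
- by move=> p _; exact: after_le1.
Qed.

Definition tail (x : 'rV[R]_n) : R := \int[lam]_(s in I) (g (upd i s x) * after x s).

Lemma ae_integrable_tail : {ae mu, forall x, O x ->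
  lam.-integrable I (fun s => (g (upd i s x) * after x s)%:E)}.
Proof.
exact: (ae_integrable_rectangle (measurable_obox a b) measurable_side integrable_tail).
Qed.

Lemma integrable_tail_int : mu.-integrable O (EFin \o tail).
Proof.
have H := integrable_integral_rectangle (measurable_obox a b) measurable_side integrable_tail.
have mt : measurable_fun O tail.
  have mF := measurableT_comp (@fine_measurable R setT measurableT) (measurable_int _ H).
  exact: mF.
apply: (le_integrable (measurable_obox a b) _ _ H).
  exact/measurable_EFinP.
move=> x _ /=; rewrite /tail /Rintegral.
(* Where the inner integral is infinite, [fine] gives [tail] the value 0, which is still
   dominated. *)
by case: (integral _ _ _) => [r||] //=; rewrite ?leey.
Qed.

(* [tail x] is the integral of [g] from [x] to the face [x_i = b i], so [f + tail]
   does not depend on [x_i] if [g] is the [i]-th derivative of [f]. *)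
Definition line_invariant (x : 'rV[R]_n) : R := f x + tail x.

Lemma integrable_line_invariant : mu.-integrable O (EFin \o line_invariant).
Proof. exact: (integrableD (measurable_obox a b) intf integrable_tail_int). Qed.

Hypothesis weak : forall rho, (forall j, smooth1 (rho j)) ->
  (forall j t, t \notin `]a j, b j[ -> rho j t = 0) ->
  (\int[mu]_(x in O) (f x * partial i (prodf rho) x)%:E =
   - \int[mu]_(x in O) (g x * prodf rho x)%:E)%E.

Local Notation h := line_invariant.

Section test.
Variable rho : 'I_n -> R -> R.
Hypotheses (srho : forall j, smooth1 (rho j))
  (rho0 : forall j t, t \notin `]a j, b j[ -> rho j t = 0)
  (rho1 : forall j t, `|rho j t| <= 1).

Lemma prodf_setf_le (k : R -> R) (c : R) x : (forall t, `|k t| <= c) ->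
  `|prodf (setf rho i k) x| <= c.
Proof.
move=> kc; rewrite prodf_setf normrM -[leRHS]mulr1.
apply: ler_pM => //; rewrite normr_prod.
by apply: Num.Theory.prodr_ile1 => j _; rewrite normr_ge0 rho1.
Qed.

Lemma measurable_prodf_setf (k : R -> R) : smooth1 k ->
  measurable_fun setT (prodf (setf rho i k)).
Proof.
move=> sk; apply: measurable_prodf => j.
by apply: smooth1_continuous; exact: smooth1_setf.
Qed.

Section kernel.
Variables (k : R -> R) (c : R).
Hypotheses (sk : smooth1 k) (k0 : forall t, t \notin `]a i, b i[ -> k t = 0)
  (kc : forall t, `|k t| <= c).

Lemma integrable_kernel : lam.-integrable setT (EFin \o k).
Proof.
have mk D : measurable_fun D k.
  by apply: measurable_funTS; apply: continuous_measurable_fun; exact: smooth1_continuous.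
have : lam.-integrable I (EFin \o k).
  apply: measurable_bounded_integrable => //.
  - exact: lebesgue_side_lty.
  - exact: mk.
  - by exists c; split; [exact: num_real|move=> r cr x _; exact: le_trans (ltW cr)].
move/(integrable_mkcond _ measurable_side); apply: eq_integrable => // t _.
by rewrite patchE; case: ifPn => //=; rewrite notin_setE => /negP/k0 ->.
Qed.

(** Integration by parts in Fubini form: exchanging [x_i] with the variable [s] of [tail] turns [g]
    at the moved point into [g x], and leaves the integral of [k] up to [x_i]. *)
Lemma integral_tail_kernel :
  (\int[mu]_(x in O) (tail x * prodf (setf rho i k) x)%:E =
   \int[mu]_(x in O) (g x * prodf (setf rho i (primitive k)) x)%:E)%E.
Proof.
pose F (p : 'rV[R]_n * RR) :=
  (g (upd i p.2 p.1) * after p.1 p.2 * prodf (setf rho i k) p.1)%:E.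
have intF : nu.-integrable (O `*` I) F.
  apply: (integrable_mul_bounded (c := c) measurable_obox_side integrable_tail).
    have mP := measurableT_comp (measurable_prodf_setf sk) (@measurable_fst _ _ _ RR).
    exact: measurable_funTS mP.
  by move=> p _; exact: prodf_setf_le.
transitivity (\int[nu]_(p in O `*` I) F p)%E.
  rewrite (integral_rectangle (measurable_obox a b) measurable_side intF).
  apply: ae_eq_integral_nomeas; apply: filterS ae_integrable_tail => x /[apply] ix.
  rewrite /F /= EFinM /tail /Rintegral fineK; last exact: (integrable_fin_num measurable_side ix).
  under [RHS]eq_integral do rewrite EFinM.
  by rewrite (integralZr measurable_side)//; exact: ix.
rewrite -(integral_obox_swapr intF).
have := integrable_swapr i measurable_obox_side intF; rewrite swapr_obox => intFs.
rewrite (integral_rectangle (measurable_obox a b) measurable_side intFs).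
apply: eq_integral => x _.
have E t : F (swapr i (x, t)) = (g x * (\prod_(j | j != i) rho j (x ord0 j)) *
    (k t * \1_(`]-oo, x ord0 i]%classic : set R) t))%:E.
  rewrite /F /swapr /= upd_upd upd_id prodf_setf_upd /after upd_coord.
  rewrite (_ : \1_(`[0, +oo[%classic : set R) _ = \1_(`]-oo, x ord0 i]%classic : set R) t);
    last first.
    by rewrite !indicE; congr (_%:R); congr nat_of_bool; apply/idP/idP;
      rewrite !inE /= !in_itv /= ?andbT subr_ge0.
  by congr EFin; ring.
transitivity (\int[lam]_(t in I) ((g x * \prod_(j | j != i) rho j (x ord0 j))%:E *
    (k t * \1_(`]-oo, x ord0 i]%classic : set R) t)%:E))%E.
  by apply: eq_integral => t _; rewrite -EFinM -E.
have intk : lam.-integrable I (fun t => (k t * \1_(`]-oo, x ord0 i]%classic : set R) t)%:E).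
  apply: (integrable_mul_bounded (c := 1) measurable_side).
  - by apply: integrableS integrable_kernel => //; exact: measurable_side.
  - by apply: measurable_indic; exact: measurable_itv.
  - by move=> t _; rewrite indicE; case: (_ \in _); rewrite ?normr1 ?normr0.
rewrite (integralZl measurable_side intk) prodf_setf mulrCA [in RHS]EFinM [RHS]muleC.
congr (_ * _)%E.
rewrite /primitive /Rintegral fineK; last first.
  have mD : measurable (`]-oo, x ord0 i]%classic : set RR) by exact: measurable_itv.
  exact: (integrable_fin_num mD (integrableS measurableT mD (@subsetT _ _) integrable_kernel)).
rewrite integral_mkcond [RHS]integral_mkcond; apply: eq_integral => t _.
rewrite !patchE indicE.
have [tx|tx] := boolP (t \in `]-oo, x ord0 i]%classic); last first.
  by rewrite mulr0; case: ifP.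
rewrite mulr1; case: ifPn => //.
by rewrite notin_setE => /negP/k0 ->.
Qed.

(** The weak identity is tested on the primitive of [k], which vanishes outside the side because [k]
    has mean zero. Its right-hand side is minus the integral of [tail] against [k], so the two parts
    of the invariant cancel. *)
Lemma integral_line_invariant_kernel : \int[lam]_t k t = 0 ->
  (\int[mu]_(x in O) (line_invariant x * prodf (setf rho i k) x)%:E = 0)%E.
Proof.
move=> ik; have [sK dK] := smooth1_primitiveE sk integrable_kernel.
have := weak (smooth1_setf i srho sK).
have -> : partial i (prodf (setf rho i (primitive k))) = prodf (setf rho i k).
  rewrite partial_prodf; last exact: smooth1_setf.
  apply/funext => x; apply: eq_bigr => j _; rewrite /setf.
  case: eqVneq => // _; rewrite eqxx derive1E.
  by have [_ ->] := dK (x ord0 j).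
rewrite -integral_tail_kernel => W.
have bk D : measurable_fun D (prodf (setf rho i k)).
  exact: measurable_funTS (measurable_prodf_setf sk).
have I1 : mu.-integrable O (fun x => (f x * prodf (setf rho i k) x)%:E).
  apply: (integrable_mul_bounded (c := c) (measurable_obox a b) intf) => // x _.
  exact: prodf_setf_le.
have I2 : mu.-integrable O (fun x => (tail x * prodf (setf rho i k) x)%:E).
  apply: (integrable_mul_bounded (c := c) (measurable_obox a b) integrable_tail_int) => // x _.
  exact: prodf_setf_le.
under eq_integral do rewrite mulrDl EFinD.
rewrite (integralD (measurable_obox a b) I1 I2) W; last first.
  move=> j t tj; rewrite /setf; case: eqVneq tj => [->|_] tj; last exact: rho0.
  exact: primitive_eq0 tj.
rewrite addeC subee//; exact: (integrable_fin_num (measurable_obox a b) I2).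
Qed.

End kernel.

(* With [A] and [B] the integrals of [k] and [l], the kernel [A l - B k] has
   integral 0; writing [A] and [B] as integrals in the extra coordinate and
   exchanging coordinates turns [h] into the difference of its values. *)
Lemma integral_line_invariant_diff (k l : R -> R) : smooth1 k -> smooth1 l ->
  (forall t, t \notin `]a i, b i[ -> k t = 0) ->
  (forall t, t \notin `]a i, b i[ -> l t = 0) ->
  (forall t, `|k t| <= 1) -> (forall t, `|l t| <= 1) ->
  (\int[nu]_(p in O `*` I) ((h (upd i p.2 p.1) - h p.1) *
     (prodf (setf rho i k) p.1 * l p.2))%:E = 0)%E.
Proof.
move=> sk sl k0 l0 k1 l1.
have inth := integrable_line_invariant.
pose W (k l : R -> R) (p : 'rV[R]_n * RR) := h p.1 * (prodf (setf rho i k) p.1 * l p.2).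
have intW k' l' : smooth1 k' -> smooth1 l' -> (forall t, `|k' t| <= 1) ->
    (forall t, `|l' t| <= 1) -> nu.-integrable (O `*` I) (EFin \o W k' l').
  move=> sk' sl' k1' l1'.
  apply: (integrable_mul_bounded (c := 1) measurable_obox_side).
  - exact: integrable_obox_fst inth.
  - apply: measurable_funTS; apply: measurable_funM.
      exact: (measurableT_comp (measurable_prodf_setf sk') (@measurable_fst _ _ _ RR)).
    have ml : measurable_fun setT l'.
      by apply: continuous_measurable_fun; exact: smooth1_continuous.
    exact: (measurableT_comp ml (@measurable_snd _ _ 'rV[R]_n RR)).
  - move=> p _; rewrite normrM -[leRHS]mulr1.
    by apply: ler_pM => //; exact: prodf_setf_le.
(* The weight [k (x_i) * l t] is the same in both terms: moving to the swapped point exchanges the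
   roles of [k] and [l]. *)
have E p : (h (upd i p.2 p.1) - h p.1) * (prodf (setf rho i k) p.1 * l p.2) =
    W l k (swapr i p) - W k l p.
  rewrite /W /swapr /= prodf_setf_upd prodf_setf; ring.
under eq_integral do rewrite E EFinB.
have := integrable_swapr i measurable_obox_side (intW l k sl sk l1 k1).
rewrite swapr_obox => intWs.
rewrite (integralB_EFin measurable_obox_side intWs (intW _ _ sk sl k1 l1)).
rewrite (integral_obox_swapr (intW l k sl sk l1 k1)).
rewrite -(integralB_EFin measurable_obox_side (intW _ _ sl sk l1 k1) (intW _ _ sk sl k1 l1)).
have intWB := integrableB measurable_obox_side (intW _ _ sl sk l1 k1) (intW _ _ sk sl k1 l1).
rewrite (integral_rectangle (measurable_obox a b) measurable_side intWB).
have ik := integrable_kernel sk k0 k1; have il := integrable_kernel sl l0 l1.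
pose A := \int[lam]_t k t; pose B := \int[lam]_t l t.
have intI (q : R -> R) : lam.-integrable setT (EFin \o q) ->
    (forall t, t \notin `]a i, b i[ -> q t = 0) ->
    (\int[lam]_(t in I) (q t)%:E = (\int[lam]_t q t)%:E)%E.
  move=> iq q0; rewrite /Rintegral fineK; last exact: (integrable_fin_num measurableT iq).
  rewrite [LHS]integral_mkcond; apply: eq_integral => t _; rewrite patchE.
  by case: ifPn => //; rewrite notin_setE => /negP/q0 ->.
transitivity (\int[mu]_(x in O)
    (h x * prodf (setf rho i (fun t => A * l t + (- B) * k t)) x)%:E)%E.
  apply: eq_integral => x _.
  have ikI : lam.-integrable I (EFin \o k) by apply: integrableS ik => //; exact: measurable_side.
  have ilI : lam.-integrable I (EFin \o l) by apply: integrableS il => //; exact: measurable_side.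
  transitivity (\int[lam]_(t in I) ((h x * prodf (setf rho i l) x)%:E * (k t)%:E -
      (h x * prodf (setf rho i k) x)%:E * (l t)%:E))%E.
    by apply: eq_integral => t _; rewrite /W /= -!EFinM !mulrA.
  rewrite (integralB measurable_side); last 2 first.
  - exact: (integrableZl measurable_side _ ikI).
  - exact: (integrableZl measurable_side _ ilI).
  rewrite (integralZl measurable_side ikI) (integralZl measurable_side ilI).
  rewrite !intI// -/A -/B -!EFinM -EFinB; congr EFin.
  rewrite !prodf_setf; ring.
have sAB : smooth1 (fun t => A * l t + (- B) * k t) by exact: smooth1_lin.
apply: (@integral_line_invariant_kernel _ (`|A| + `|B|)) => //.
- by move=> t tI; rewrite k0// l0// !mulr0 addr0.
- move=> t; apply: le_trans (ler_normD _ _) _; rewrite !normrM normrN.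
  by apply: lerD; rewrite ler_piMr.
- rewrite RintegralD//; last 2 first.
  + exact: (integrableZl measurableT A il).
  + exact: (integrableZl measurableT (- B) ik).
  rewrite !RintegralZl// -/A -/B; ring.
Qed.

End test.

Lemma ray_side (S : set R) (c d : R) : rays S ->
  exists e, c <= e /\ forall t, t \in `]c, d[ -> \1_S t = \1_(`]e, d[%classic) t :> R.
Proof.
move=> [->|[e ->]].
  exists c; split => // t td; rewrite indicT indicE mem_set//.
exists (Num.max c e); split => [|t]; first by rewrite le_max lexx.
rewrite !indicE in_itv /= => /andP[ct td]; congr (_%:R); congr nat_of_bool.
by apply/idP/idP; rewrite !inE /= !in_itv /= ?andbT gt_max ct td ?andbT.
Qed.

(** Inside [O x I] the indicator of a box of rays is a pointwise limit of products of bumps. Each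
    product integrates to 0 against the difference of values, which itself dominates the
    sequence. *)
Lemma integral_line_invariant_rays (A : 'I_n -> set R) (C : set RR) :
  (forall j, rays (A j)) -> rays C ->
  (\int[nu]_(p in (boxset A `*` C) `&` (O `*` I))
     (h (upd i p.2 p.1) - h p.1)%:E = 0)%E.
Proof.
move=> rA rC.
have /choice[c_ Hc] : forall j, exists e, a j <= e /\
    forall t, t \in `]a j, b j[ -> \1_(A j) t = \1_(`]e, b j[%classic) t :> R.
  by move=> j; exact: ray_side.
have [c [ac HC]] := ray_side (a i) (b i) rC.
pose Phi (p : 'rV[R]_n * RR) := h (upd i p.2 p.1) - h p.1.
have intPhi : nu.-integrable (O `*` I) (EFin \o Phi).
  exact: (integrableB measurable_obox_side (integrable_obox_upd integrable_line_invariant)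
    (integrable_obox_fst integrable_line_invariant)).
pose rho m j := bump (c_ j) (b j) m.
pose T m (p : 'rV[R]_n * RR) := prodf (rho m) p.1 * bump c (b i) m p.2.
have bump0 e d m t d' : d' <= e -> t \notin `]d', d[ -> bump e d m t = 0.
  move=> de td; apply: bump_eq0; apply: contra td; rewrite !in_itv /=.
  by move=> /andP[et ->]; rewrite (le_lt_trans de).
have bump1 e d m t : `|bump e d m t| <= 1.
  by have /andP[b0 b1] := bump_le1 e d m t; rewrite ger0_norm.
have setfE m : setf (rho m) i (rho m i) = rho m.
  by apply/funext => j; rewrite /setf; case: eqVneq => // ->.
have T0 m : (\int[nu]_(p in O `*` I) (Phi p * T m p)%:E = 0)%E.
  have := @integral_line_invariant_diff (rho m) _ _ _ (rho m i) (bump c (b i) m).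
  rewrite setfE; apply.
  - by move=> j; exact: smooth1_bump.
  - by move=> j t; apply: bump0; have [] := Hc j.
  - by move=> j t; exact: bump1.
  - exact: smooth1_bump.
  - exact: smooth1_bump.
  - by move=> t; apply: bump0; have [] := Hc i.
  - by move=> t; exact: bump0.
  - by move=> t; exact: bump1.
  - by move=> t; exact: bump1.
have mT m : measurable_fun (O `*` I) (T m).
  apply: measurable_funTS; apply: measurable_funM.
    have mr : measurable_fun setT (prodf (rho m)).
      by apply: measurable_prodf => j; apply: smooth1_continuous; exact: smooth1_bump.
    exact: (measurableT_comp mr (@measurable_fst _ _ _ RR)).
  have ml : measurable_fun setT (bump c (b i) m).
    by apply: continuous_measurable_fun; apply: smooth1_continuous; exact: smooth1_bump.
  exact: (measurableT_comp ml (@measurable_snd _ _ 'rV[R]_n RR)).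
have T1 m p : `|T m p| <= 1.
  rewrite normrM normr_prod -[leRHS]mulr1; apply: ler_pM; rewrite ?bump1//.
    exact: prodr_ge0.
  by apply: Num.Theory.prodr_ile1 => j _; rewrite normr_ge0 bump1.
have mPhi : measurable_fun (O `*` I) Phi by apply/measurable_EFinP; exact: measurable_int intPhi.
have mS : measurable (boxset A `*` C : set ('rV[R]_n * RR)).
  have mR (S : set RR) : rays S -> measurable S.
    by move=> rS; rewrite g_sigma_algebra_rays; exact: sub_sigma_algebra.
  by apply: measurableX; [apply: measurable_boxset => j|]; exact: mR.
rewrite -[LHS]/(\int[nu]_(p in (boxset A `*` C) `&` (O `*` I)) (EFin \o Phi) p)%E.
rewrite integral_mkcondl.
have [] := @dominated_convergence _ _ _ nu (O `*` I) measurable_obox_side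
  (fun m p => (Phi p * T m p)%:E) ((EFin \o Phi) \_ (boxset A `*` C))
  (fun p => `|(Phi p)%:E|%E).
- by move=> m; apply/measurable_EFinP; apply: measurable_funM.
- apply/(measurable_restrict _ mS measurable_obox_side).
  apply: measurable_funS measurable_obox_side _ _; first exact: subIsetl.
  exact/measurable_EFinP.
- apply: aeW => -[x t] [/= Ox It].
  have cT : T m (x, t) @[m --> \oo] --> ((\prod_j \1_(A j) (x ord0 j)) * (\1_C t) : R).
    rewrite HC//; apply: cvgM; last exact: cvg_bump.
    rewrite (eq_bigr (fun j => \1_(`]c_ j, b j[%classic) (x ord0 j))); last first.
      by move=> j _; have [_ ->] := Hc j => //; exact: Ox.
    rewrite /T /= /prodf; apply: cvg_big => [|j _]; last exact: cvg_bump.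
    exact: mul_continuous.
  have -> : ((EFin \o Phi) \_ (boxset A `*` C)) (x, t) =
      (Phi (x, t) * ((\prod_j \1_(A j) (x ord0 j)) * \1_C t))%:E.
    rewrite patchE; case: ifPn => [/set_mem[/= Ax Ct]|].
      rewrite big1 ?indicE ?mem_set ?mulr1// => j _; rewrite indicE mem_set//; exact: Ax.
    rewrite notin_setE /= => /not_andP[/existsNP[j /= Aj]|/= Ct].
      by rewrite (bigD1 j)//= indicE memNset// !mul0r mulr0.
    by rewrite [\1_C t]indicE memNset// !mulr0.
  by apply: cvg_EFin; [exact: nearW|exact: cvgMr].
- exact: integrable_abse intPhi.
- by apply: aeW => p m _; rewrite lee_fin normrM ler_piMr.
move=> _ _; under eq_fun do rewrite T0.
move=> H; rewrite -(cvg_lim (@ereal_hausdorff R) H).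
by apply: cvg_lim; [exact: ereal_hausdorff|exact: cvg_cst].
Qed.

(** A du Bois-Reymond lemma: the difference of values is integrable and integrates to 0 over a
    generating pi-system, hence vanishes almost everywhere. *)
Theorem absolutely_continuous_on_lines :
  {ae nu, forall p, (O `*` I) p -> h (upd i p.2 p.1) = h p.1}.
Proof.
have intPhi : nu.-integrable (O `*` I)
    (fun p : 'rV[R]_n * RR => (h (upd i p.2 p.1) - h p.1)%:E).
  exact: (integrableB measurable_obox_side (integrable_obox_upd integrable_line_invariant)
    (integrable_obox_fst integrable_line_invariant)).
have := @ae_eq0_generator _ _ _ nu (@boxes R n (@rays R)) _ _
  (@g_sigma_algebra_boxes R n _ (@rays_setT R) (@g_sigma_algebra_rays R))
  (@setI_closed_boxes R n _ (@setI_closed_rays R)) measurable_obox_side intPhi.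
have T : boxset (fun=> setT) `*` setT = setT :> set ('rV[R]_n * RR).
  by apply/seteqP; split.
have H (S : set ('rV[R]_n * RR)) : boxes (@rays R) S ->
    (\int[nu]_(p in S `&` (O `*` I)) (h (upd i p.2 p.1) - h p.1)%:E = 0)%E.
  by move=> [A [C [rA rC ->]]]; exact: integral_line_invariant_rays.
move=> /(_ _ H) ae0.
apply: filterS (ae0 _) => [p /[apply] [[]] /eqP|].
  by rewrite subr_eq0 => /eqP.
(* The total integral is the case of the box all of whose sides are [setT]. *)
rewrite -[X in integral _ X](setTI (O `*` I)) -T; apply: H.
by exists (fun=> setT), setT; split => // *; exact: rays_setT.
Qed.

End antiderivative.

End lines.

(** * Harnack inequality on lines *)

Section gronwall.
Context (R : realType).
Implicit Types (y G : R -> R) (s t : R).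

(* For [G t] the integral of [v] up to [t], this is what
   [|y t - y s| <= int_s^t v y] yields. *)
Definition gronwall_bound y G (a b : R) := forall s t K, a <= s -> s <= t -> t <= b ->
  (forall r, s <= r <= t -> y r <= K) -> `|y t - y s| <= K * (G t - G s).

(** If [G] grows by at most 1/2, then [y] oscillates by at most half its supremum. So the supremum
    is at most twice the value at either endpoint. *)
Lemma gronwall_small y G a b : a <= b -> (forall r, a <= r <= b -> 0 <= y r) ->
  (exists K, forall r, a <= r <= b -> y r <= K) ->
  (forall s t, a <= s -> s <= t -> t <= b -> G s <= G t) ->
  gronwall_bound y G a b -> G b - G a <= 2^-1 -> y a <= 2 * y b /\ y b <= 2 * y a.
Proof.
move=> ab y0 [K0 yK0] ndG H Gab.
pose S := [set y r | r in [set r | a <= r <= b]].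
have Sy r : a <= r <= b -> y r <= sup S.
  move=> rab; apply: ub_le_sup; last by exists r.
  by exists K0 => _ [q qab <-]; exact: yK0.
have aab : a <= a <= b by rewrite lexx.
have bab : a <= b <= b by rewrite lexx ab.
have S0 : 0 <= sup S by apply: le_trans (Sy _ aab); exact: y0.
have SN (P : R) : (forall r, a <= r <= b -> y r <= P) -> sup S <= P.
  by move=> yP; apply: ge_sup; [exists (y a), a|move=> _ [r rab <-]; exact: yP].
have half s t : a <= s -> s <= t -> t <= b -> `|y t - y s| <= sup S / 2.
  move=> sa st tb; apply: (le_trans (H s t (sup S) sa st tb _)).
    by move=> r /andP[sr rt]; apply: Sy; rewrite (le_trans sa sr) (le_trans rt tb).
  rewrite ler_wpM2l//; apply: le_trans Gab; apply: lerB; apply: ndG => //.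
    exact: le_trans sa st.
  exact: le_trans st tb.
have Ka : sup S <= y a + sup S / 2.
  apply: SN => r /andP[ar rb]; rewrite -lerBlDl.
  by apply: le_trans (half a r _ _ _) => //; exact: ler_norm.
have Kb : sup S <= y b + sup S / 2.
  apply: SN => r /andP[ar rb]; rewrite -lerBlDl.
  by apply: le_trans (half r b _ _ _) => //; rewrite distrC; exact: ler_norm.
have := Sy _ aab; have := Sy _ bab; split; lra.
Qed.

(* The interval is cut into pieces on which [G] grows by [1 / 2]; each costs a
   factor 2. *)
Lemma gronwall y G a b (N : nat) : a <= b -> (forall r, a <= r <= b -> 0 <= y r) ->
  (exists K, forall r, a <= r <= b -> y r <= K) ->
  {within `[a, b], continuous G} ->
  (forall s t, a <= s -> s <= t -> t <= b -> G s <= G t) ->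
  gronwall_bound y G a b -> 2 * (G b - G a) <= N.+1%:R ->
  y a <= 2 ^+ N.+1 * y b /\ y b <= 2 ^+ N.+1 * y a.
Proof.
elim: N a b => [|N IH] a b ab y0 yK cG ndG H GN.
  by rewrite expr1; apply: gronwall_small H _ => //; lra.
have [small|large] := leP (2 * (G b - G a)) N.+1%:R.
  have [y1 y2] := IH _ _ ab y0 yK cG ndG H small.
  have b0 : 0 <= y b by apply: y0; rewrite ab lexx.
  have a0 : 0 <= y a by apply: y0; rewrite ab lexx.
  rewrite exprS; split; [apply: le_trans y1 _|apply: le_trans y2 _];
    by rewrite -mulrA ler_peMl ?mulr_ge0 ?exprn_ge0// ler1n.
have N1 : (1 : R) <= N.+1%:R by rewrite ler1n.
have GaGb : G a <= G b by exact: ndG.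
have [p /andP[ap pb] Gp] : exists2 p, a <= p <= b & G p = G a + 2^-1.
  have [|p pab Gp] := @IVT R G a b (G a + 2^-1) ab cG.
    by rewrite min_l// max_r//; lra.
  by exists p.
have sub1 r : a <= r <= p -> a <= r <= b.
  by move=> /andP[-> /le_trans]; exact.
have sub2 r : p <= r <= b -> a <= r <= b.
  by move=> /andP[pr ->]; rewrite (le_trans ap pr).
have [K yK'] := yK.
have [y1 y2] : y a <= 2 * y p /\ y p <= 2 * y a.
  apply: (@gronwall_small y G) => //.
  - by move=> r /sub1; exact: y0.
  - by exists K => r /sub1; exact: yK'.
  - by move=> s t sa st tp; apply: ndG => //; exact: le_trans pb.
  - by move=> s t L sa st tp; apply: H => //; exact: le_trans pb.
  - by rewrite Gp; lra.
have [y3 y4] : y p <= 2 ^+ N.+1 * y b /\ y b <= 2 ^+ N.+1 * y p.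
  apply: (IH p b) => //.
  - by move=> r /sub2; exact: y0.
  - by exists K => r /sub2; exact: yK'.
  - by apply: continuous_subspaceW cG; apply: subset_itvr; rewrite bnd_simp.
  - by move=> s t sp st tb; apply: ndG => //; exact: le_trans sp.
  - by move=> s t L sp st tb; apply: H => //; exact: le_trans sp.
  - by rewrite Gp; move: GN; rewrite -[in _ <= N.+2%:R]natr1; lra.
have e0 : (0 : R) <= 2 ^+ N.+1 by rewrite exprn_ge0.
rewrite exprS -!mulrA; split.
  by apply: le_trans y1 _; rewrite ler_wpM2l.
by apply: le_trans y4 _; rewrite mulrCA ler_wpM2l.
Qed.

End gronwall.

Section line_gronwall.
Context (R : realType) (M : nat) (a b : R) (g : 'I_M -> R -> R) (v : R -> R) (c : 'I_M -> R).
Notation RR := (measurableTypeR R).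
Notation lam := (@lebesgue_measure R).
Notation I := (`]a, b[%classic : set RR).
Notation after s r := (\1_(`[0, +oo[%classic : set R) (r - s) : R).
Hypothesis intg : forall k, lam.-integrable I (EFin \o g k).
Hypothesis intv : lam.-integrable I (EFin \o v).
Hypothesis v0 : forall s, I s -> 0 <= v s.

Let mI : measurable I. Proof. exact: measurable_itv. Qed.

(** The integral of [g k] from [s] to [b]. With [c k] the value of the line invariant, [c k - D k s]
    is the absolutely continuous version of the [k]-th component. *)
Let D k (s : R) : R := \int[lam]_(r in I) (g k r * after s r).
Let y (s : R) : R := \sum_k `|c k - D k s|.

Hypothesis gvy : {ae lam, forall s, I s -> \sum_k `|g k s| <= v s * y s}.

Let afterE s r : after s r = \1_(`[s, +oo[%classic : set R) r.
Proof.
rewrite !indicE; congr (_%:R); congr nat_of_bool.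
by apply/idP/idP; rewrite !inE /= !in_itv /= ?andbT subr_ge0.
Qed.

Let tailE k s : a < s ->
  D k s = \int[lam]_(r in [set` Interval (BLeft s) (BLeft b)]) g k r.
Proof.
move=> sa; rewrite /D Rintegral_mkcond [RHS]Rintegral_mkcond.
apply: eq_Rintegral => r _; rewrite !patchE afterE indicE.
have [rs|rs] := boolP (r \in [set` Interval (BLeft s) (BLeft b)]).
  move: (rs); rewrite inE /= in_itv /= => /andP[sr rb].
  rewrite mem_set /=; last by rewrite in_itv /= (lt_le_trans sa sr).
  by rewrite mem_set ?mulr1//= in_itv /= sr.
case: ifPn => // /set_mem /=; rewrite in_itv /= => /andP[ar rb].
rewrite memNset ?mulr0// /= in_itv /= andbT => sr.
by move: rs; rewrite notin_setE /= in_itv /= sr rb.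
Qed.

Let sub s t : a < s -> t < b -> `[s, t[%classic `<=` I.
Proof.
move=> sa tb r /=; rewrite !in_itv /= => /andP[sr rt].
by rewrite (lt_le_trans sa sr) (lt_trans rt tb).
Qed.

(** Extended by 0 outside [I], [v] is integrable on every interval, whatever its endpoints. *)
Let G (t : R) : R := \int[lam]_(r in `[a, t]) (v \_ I) r.

Let intvI : lam.-integrable setT (EFin \o (v \_ I)).
Proof.
move/(integrable_mkcond _ mI) : intv; apply: eq_integrable => // r _.
by rewrite /= !patchE; case: ifP.
Qed.

Let mitv (i : interval R) : measurable ([set` i] : set RR).
Proof. exact: measurable_itv. Qed.

Let intvIi (i : interval R) : lam.-integrable [set` i] (EFin \o (v \_ I)).
Proof. exact: (integrableS measurableT (mitv i) (@subsetT _ _) intvI). Qed.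

Let vI0 r : 0 <= (v \_ I) r.
Proof. by rewrite patchE; case: ifPn => // /set_mem; exact: v0. Qed.

Let GB s t : a <= s -> s <= t -> G t - G s = \int[lam]_(r in `[s, t[) (v \_ I) r.
Proof.
move=> sa st; rewrite /G Rintegral_itvB ?bnd_simp//.
  by rewrite Rintegral_itv_obnd_cbnd// -?Rintegral_itv_bndo_bndc//; exact: intvIi.
Qed.

Let DB k s t : a < s -> s <= t -> t < b ->
  D k s - D k t = \int[lam]_(r in `[s, t[) g k r.
Proof.
move=> sa st tb; rewrite !tailE//; last exact: lt_le_trans st.
have U : [set` Interval (BLeft s) (BLeft b)] =
    [set` Interval (BLeft s) (BLeft t)] `|` [set` Interval (BLeft t) (BLeft b)] :> set RR.
  by apply: itv_bndbnd_setU; rewrite bnd_simp// ltW.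
rewrite U Rintegral_setU//.
- by rewrite addrK.
- rewrite -U; apply: (integrableS mI _ _ (intg k)); first exact: mitv.
  by move=> r /=; rewrite !in_itv /= => /andP[sr ->]; rewrite (lt_le_trans sa).
- apply/disj_setPS => r [/=]; rewrite !in_itv /= => /andP[_ rt] /andP[tr _].
  by move: rt; rewrite ltNge tr.
Qed.

Let ynorm s t : a < s -> s <= t -> t < b ->
  ((`|y t - y s|)%:E <= \int[lam]_(r in `[s, t[) (\sum_k `|g k r|)%:E)%E.
Proof.
move=> sa st tb.
have ms : measurable (`[s, t[%classic : set RR) by exact: mitv.
have ig k : lam.-integrable `[s, t[%classic (EFin \o g k).
  exact: (integrableS mI ms (sub sa tb) (intg k)).
apply: (@le_trans _ _ (\sum_k (`|D k s - D k t|)%:E)%E).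
  rewrite sumEFin lee_fin -sumrB; apply: le_trans (ler_norm_sum _ _ _) _.
  apply: ler_sum => k _.
  have -> : D k s - D k t = (c k - D k t) - (c k - D k s) by ring.
  exact: ler_dist_dist.
under [leRHS]eq_integral do rewrite -sumEFin.
rewrite ge0_integral_sum//; last first.
  move=> k; apply/measurable_EFinP; apply: measurableT_comp => //.
  by apply/measurable_EFinP; exact: (measurable_int _ (ig k)).
apply: lee_sum => k _; rewrite DB// /Rintegral -abse_EFin fineK.
  by apply: le_abse_integral => //; exact: (measurable_int _ (ig k)).
exact: (integrable_fin_num ms (ig k)).
Qed.

Let gb s0 t0 : a < s0 -> t0 < b -> gronwall_bound y G s0 t0.
Proof.
move=> as0 t0b s t K s0s st tt0 yK.
have sa : a < s by exact: lt_le_trans s0s.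
have tb : t < b by exact: le_lt_trans tt0 t0b.
have y0 r : 0 <= y r by apply: sumr_ge0.
have K0 : 0 <= K by apply: le_trans (yK s _); rewrite ?lexx.
have ms : measurable (`[s, t[%classic : set RR) by exact: mitv.
rewrite -lee_fin; apply: le_trans (ynorm sa st tb) _.
have mg k : measurable_fun `[s, t[%classic (g k).
  apply/measurable_EFinP; apply: (measurable_int lam).
  exact: (integrableS mI ms (sub sa tb) (intg k)).
apply: (@le_trans _ _ (\int[lam]_(r in `[s, t[) (K%:E * ((v \_ I) r)%:E))%E).
  apply: ae_ge0_le_integral => //.
  - by move=> r _; rewrite lee_fin; apply: sumr_ge0.
  - apply/measurable_EFinP; apply: measurable_sum => k.
    by apply: measurableT_comp (mg k).
  - by move=> r _; rewrite mule_ge0// lee_fin.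
  - apply: emeasurable_funM => //; exact: (measurable_int _ (intvIi _)).
  apply: filterS gvy => r gr rst.
  have Ir : I r by apply: (sub sa tb).
  rewrite lee_fin; apply: le_trans (gr Ir) _.
  rewrite patchE mem_set// mulrC ler_wpM2r ?v0//; apply: yK.
  by move: rst; rewrite /= in_itv /= => /andP[-> /ltW].
rewrite (integralZl ms (intvIi `[s, t[)).
rewrite EFinM (GB (ltW sa) st) lee_wpmul2l// /Rintegral fineK//.
exact: (integrable_fin_num ms (intvIi _)).
Qed.

Let ybounded : exists K, forall r, y r <= K.
Proof.
exists (\sum_k (`|c k| + \int[lam]_(r in I) `|g k r|)) => r.
apply: ler_sum => k _; apply: le_trans (ler_normB _ _) _; rewrite lerD2l.
have ma : measurable_fun I (fun q => after r q).
  have mi : measurable_fun setT (\1_(`[0, +oo[%classic : set R) : R -> R).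
    by apply: measurable_indic; exact: measurable_itv.
  apply: measurable_funTS; apply: (measurableT_comp mi).
  exact: measurable_funB.
have a1 q : `|after r q| <= 1.
  by rewrite indicE; case: (_ \in _); rewrite ?normr1 ?normr0.
have ig : lam.-integrable I (fun q => (g k q * after r q)%:E).
  exact: (integrable_mul_bounded mI (intg k) ma (fun q _ => a1 q)).
apply: le_trans (le_normr_Rintegral mI ig) _.
apply: le_Rintegral => //.
- exact: (integrable_norm ig).
- exact: (integrable_norm (intg k)).
- by move=> q _; rewrite normrM ler_piMr.
Qed.

Let cG s t : a <= s -> s <= t -> {within `[s, t], continuous G}.
Proof.
move=> sa st.
have := @parameterized_integral_continuous R a t (v \_ I) (le_trans sa st) (intvIi _).
by apply: continuous_subspaceW; apply: subset_itvr; rewrite bnd_simp.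
Qed.

Lemma line_gronwall (N : nat) s t : I s -> I t ->
  2 * \int[lam]_(r in I) v r <= N.+1%:R -> y s <= 2 ^+ N.+1 * y t.
Proof.
move=> Is It vN; suff H s' t' : s' <= t' -> I s' -> I t' ->
    y s' <= 2 ^+ N.+1 * y t' /\ y t' <= 2 ^+ N.+1 * y s'.
  by have [/H|/ltW/H] := leP s t; [case|move=> /(_ It Is)[]].
move=> {s t Is It}; move: s' t' => s t st.
rewrite /= !in_itv /= => /andP[sa sb] /andP[ta tb].
have [K yK] := ybounded.
have ndG s' t' : s <= s' -> s' <= t' -> t' <= t -> G s' <= G t'.
  move=> ss' st' tt'; rewrite -subr_ge0 GB//; last by rewrite (le_trans (ltW sa)).
  by apply: Rintegral_ge0.
have GN : 2 * (G t - G s) <= N.+1%:R.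
  apply: le_trans vN; rewrite ler_pM2l// (GB (ltW sa) st).
  rewrite [leRHS]Rintegral_mkcond [leLHS]Rintegral_mkcond; apply: le_Rintegral => //.
  - have intst := intvIi `[s, t[.
    have := (integrable_mkcond _ (mitv `[s, t[)).1 intst.
    by apply: eq_integrable => // r _; rewrite /= !patchE; by case: (r \in _).
  - by move=> r _; rewrite [leLHS]patchE; case: ifPn => // _; exact: vI0.
apply: (gronwall st _ _ (cG (ltW sa) st) ndG (gb sa tb) GN).
- by move=> r _; exact: sumr_ge0.
- by exists K.
Qed.

End line_gronwall.

Section harnack.
Context (R : realType) (n M : nat) (i : 'I_n) (a b : 'I_n -> R).
Notation RR := (measurableTypeR R).
Notation mu := (lebesgue_row R n).
Notation lam := (@lebesgue_measure R).
Notation nu := (mu \x lam)%E.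
Notation O := (obox a b).
Notation I := (`]a i, b i[%classic : set RR).
Variables (f g : 'I_M -> 'rV[R]_n -> R) (v : 'rV[R]_n -> R).
Hypotheses (intf : forall k, mu.-integrable O (EFin \o f k))
  (intg : forall k, mu.-integrable O (EFin \o g k))
  (intv : mu.-integrable O (EFin \o v)).
Hypothesis v0 : forall x, O x -> 0 <= v x.
Hypothesis weak : forall k rho, (forall j, smooth1 (rho j)) ->
  (forall j t, t \notin `]a j, b j[ -> rho j t = 0) ->
  (\int[mu]_(x in O) (f k x * partial i (prodf rho) x)%:E =
   - \int[mu]_(x in O) (g k x * prodf rho x)%:E)%E.
Local Notation U x := (\sum_k `|f k x|).
Hypothesis gv : {ae mu, forall x, O x -> \sum_k `|g k x| <= v x * U x}.

Let h k := line_invariant i a b (f k) (g k).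

Let acl : {ae nu, forall p, forall k, (O `*` I) p -> h k (upd i p.2 p.1) = h k p.1}.
Proof.
apply: filter_forall => k.
exact: (absolutely_continuous_on_lines (intf k) (intg k) (@weak k)).
Qed.

Let tail_upd k x s : tail i a b (g k) (upd i s x) =
  \int[lam]_(r in I) (g k (upd i r x) * \1_(`[0, +oo[%classic : set R) (r - s)).
Proof.
by apply: eq_Rintegral => r _; rewrite upd_upd /after upd_coord.
Qed.

Let obox_upd x s : O x -> I s -> O (upd i s x).
Proof. by move=> Ox Is; apply/boxset_upd; split => // j _; exact: Ox. Qed.

(** On almost every line the [g k] and [v] are integrable, and at almost every [s] both the
    constancy of the invariants and the differential inequality hold. There [f k] is a constant
    minus [tail], to which [line_gronwall] applies. *)
Lemma harnack_line : {ae nu, forall p, (O `*` I) p -> forall N,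
  2 * \int[lam]_(s in I) v (upd i s p.1) <= N.+1%:R ->
  U p.1 <= 2 ^+ N.+1 * U (upd i p.2 p.1)}.
Proof.
have A1 : {ae mu, forall x, forall k, O x -> lam.-integrable I (fun s => (g k (upd i s x))%:E)}.
  apply: filter_forall => k.
  exact: (ae_integrable_rectangle (measurable_obox a b) (measurable_side i a b)
    (integrable_obox_upd i (intg k))).
have A2 : {ae mu, forall x, O x -> lam.-integrable I (fun s => (v (upd i s x))%:E)}.
  exact: (ae_integrable_rectangle (measurable_obox a b) (measurable_side i a b)
    (integrable_obox_upd i intv)).
have A3 := ae_prod acl.
have A4 := ae_prod (ae_upd i gv).
have muF : Filter (almost_everywhere mu) by exact: ae_filter_ringOfSetsType.
have Q := ae_fst (@filterI _ _ muF _ _ A1 (@filterI _ _ muF _ _ A2 (@filterI _ _ muF _ _ A3 A4))).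
have nuF : Filter (almost_everywhere nu) by exact: ae_filter_ringOfSetsType.
have QA := @filterI _ _ nuF _ _ Q acl.
move: QA; apply: (@filterS _ _ nuF) => -[x t] /= [[B1 [B2 [B3 B4]]] hx] [Ox It] N vN.
(* Where the invariants take their value at [x], the sum in [line_gronwall] is [U]. At
   [s = x ord0 i] this is automatic, at [s = t] it comes from [acl]. *)
have E s : (forall k, h k (upd i s x) = h k x) ->
    \sum_k `|h k x - \int[lam]_(r in I) (g k (upd i r x) *
       \1_(`[0, +oo[%classic : set R) (r - s))| = U (upd i s x).
  move=> hs; apply: eq_bigr => k _; rewrite -tail_upd -hs /h /line_invariant.
  by rewrite addrK.
have := @line_gronwall R M (a i) (b i) (fun k s => g k (upd i s x))
  (fun s => v (upd i s x)) (fun k => h k x) (fun k => B1 k Ox) (B2 Ox) _ _ N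
  (x ord0 i) t _ It vN.
rewrite E; last by move=> k; rewrite upd_id.
rewrite upd_id E; last by move=> k; exact: hx.
apply.
- by move=> s Is; apply: v0; exact: obox_upd.
- apply: filterS2 B3 B4 => s hs gs Is.
  rewrite E; last by move=> k; apply: hs.
  by apply: gs; exact: obox_upd.
- exact: (Ox i).
Qed.

End harnack.

(** * Comparison of averages of the logarithm over cubes *)

Lemma ln2_le1 (R : realType) : ln 2 <= 1 :> R.
Proof.
rewrite -ler_expR lnK ?posrE//; apply: le_trans (expR_ge1Dx _).
by rewrite -natr1.
Qed.

(** The factor [2 ^+ N.+1] is at least 1, so it also absorbs the added 1. With [N] the integer part
    of [2 * A], its logarithm is at most [N + 1 <= 1 + 2 * A]. *)
Lemma ln_harnack (R : realType) (eps A U1 U2 : R) : 0 < eps -> 0 <= A ->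
  0 <= U1 -> 0 <= U2 ->
  (forall N, 2 * A <= N.+1%:R -> U1 <= 2 ^+ N.+1 * U2) ->
  ln (1 + U1 / eps) <= ln (1 + U2 / eps) + 1 + 2 * A.
Proof.
move=> e0 A0 U10 U20 H.
have A20 : 0 <= 2 * A by rewrite mulr_ge0.
have /andP[N1 N2] := Num.Theory.truncn_itv A20.
pose N := Num.truncn (2 * A).
have {}H := H N (ltW N2).
have p2 : (0 : R) < 2 ^+ N.+1 by rewrite exprn_gt0.
have d0 u : 0 <= u -> 0 < 1 + u / eps.
  by move=> u0; rewrite ltr_wpDr// divr_ge0// ltW.
have : ln (1 + U1 / eps) <= ln (2 ^+ N.+1 * (1 + U2 / eps)).
  rewrite ler_ln ?posrE ?mulr_gt0 ?d0// mulrDr mulr1 mulrA.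
  by apply: lerD; [rewrite exprn_ege1// ler1n|rewrite ler_pM2r ?invr_gt0].
move=> /le_trans; apply.
have ln2 : ln (2 ^+ N.+1) <= 1 + 2 * A.
  rewrite lnXn// -[ln 2 *+ _]mulr_natl; apply: (@le_trans _ _ N.+1%:R).
    by rewrite ler_piMr// ln2_le1.
  by rewrite -natr1 addrC lerD2l.
by rewrite lnM ?posrE ?d0//; lra.
Qed.

Section halving.
Context (R : realType) (n : nat) (i : 'I_n) (a b a' b' : 'I_n -> R).
Notation RR := (measurableTypeR R).
Notation mu := (lebesgue_row R n).
Notation lam := (@lebesgue_measure R).
Notation nu := (mu \x lam)%E.
Notation O := (obox a b).
Notation O' := (obox a' b').
Notation I := (`]a i, b i[%classic : set RR).
Notation J := (`]a' i, b' i[%classic : set RR).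
Hypotheses (aa' : forall j, j != i -> a' j = a j) (bb' : forall j, j != i -> b' j = b j).
Hypotheses (aa'i : a i <= a' i) (bb'i : b' i <= b i) (ab' : a' i < b' i).
Hypothesis half : b i - a i = 2 * (b' i - a' i).
Variables (w v : 'rV[R]_n -> R).
Hypotheses (mw : measurable_fun O w) (w0 : forall x, 0 <= w x).
Hypotheses (intv : mu.-integrable O (EFin \o v)) (v0 : forall x, O x -> 0 <= v x).
Local Open Scope ereal_scope.

Let JI : J `<=` I.
Proof. by apply: subset_itv; rewrite bnd_simp. Qed.

Lemma swapr_half : swapr i @^-1` (O' `*` I) = O `*` J.
Proof.
rewrite swapr_boxset; congr (_ `*` _).
apply/seteqP; split => x /= H j; have := H j;
  by case: (eqVneq j i) => [->//|ji]; rewrite aa'// bb'.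
Qed.

Let sub' : O' `<=` O.
Proof.
move=> x xO' j; have := xO' j; case: (eqVneq j i) => [->|ji]; first exact: JI.
by rewrite aa'// bb'.
Qed.

Let mJ : measurable J. Proof. exact: measurable_itv. Qed.

(* The pointwise bound is integrated over [x] in [O] and [t] in the half side
   [J]; [swapr] maps this set onto [O' x I]. *)
Lemma box_halving :
  {ae nu, forall p, (O `*` I) p ->
    (w p.1)%:E <= (w (upd i p.2 p.1))%:E +
      (1 + 2%:E * \int[lam]_(s in I) (v (upd i s p.1))%:E)} ->
  \int[mu]_(x in O) (w x)%:E <=
  2%:E * \int[mu]_(x in O') (w x)%:E +
    (mu O + 2%:E * ((b i - a i)%:E * \int[mu]_(x in O) (v x)%:E)).
Proof.
move=> H.
have mO := measurable_obox a b; have mO' := measurable_obox a' b'.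
have mI : measurable I by exact: measurable_side.
have lJ : lam J = (b' i - a' i)%:E.
  by rewrite lebesgue_measure_itv /= lte_fin ab' -EFinD.
have lI : lam I = (b i - a i)%:E.
  have ab : (a i < b i)%R by apply: le_lt_trans aa'i _; exact: lt_le_trans bb'i.
  by rewrite lebesgue_measure_itv /= lte_fin ab -EFinD.
have J0 : (0 < b' i - a' i)%R by rewrite subr_gt0.
have intvu := integrable_obox_upd i intv.
pose A x := \int[lam]_(s in I) (v (upd i s x))%:E.
have mA : measurable_fun O A.
  exact: (measurable_integral_rectangle mO mI intvu).
have A0 x : O x -> 0 <= A x.
  move=> Ox; apply: integral_ge0 => s Is; rewrite lee_fin; apply: v0.
  by apply/boxset_upd; split => // j _; exact: Ox.
have EA : \int[mu]_(x in O) A x = (b i - a i)%:E * \int[mu]_(x in O) (v x)%:E.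
  rewrite -(integral_rectangle mO mI intvu) -(swapr_obox i a b).
  have mvE : measurable_fun (O `*` I) (fun p => (v p.1)%:E).
    exact: (measurable_int _ (integrable_obox_fst i intv)).
  have := @ge0_integral_swapr R n i (O `*` I) _ (measurable_obox_side i a b) mvE _.
  move=> ->; last by move=> p [Op _]; rewrite lee_fin v0.
  have mv : measurable_fun O (fun x => (v x)%:E) by exact: (measurable_int _ intv).
  have v0E x : O x -> 0 <= (v x)%:E by move=> Ox; rewrite lee_fin v0.
  apply: (etrans (ge0_integral_fst mu lam mO mI mv v0E)).
  by rewrite muleC; congr (_ * _).
have mwE : measurable_fun O (fun x => (w x)%:E) by exact/measurable_EFinP.
have w0E (D : set 'rV[R]_n) x : D x -> 0 <= (w x)%:E by rewrite lee_fin.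
have mOJ : measurable (O `*` J : set ('rV[R]_n * RR)) by exact: measurableX.
have L : \int[nu]_(p in O `*` J) (w p.1)%:E = (\int[mu]_(x in O) (w x)%:E) * (b' i - a' i)%:E.
  apply: (etrans (ge0_integral_fst mu lam mO mJ mwE (w0E O))).
  by congr (_ * _).
have mwE' : measurable_fun O' (fun x => (w x)%:E) by exact: measurable_funS mwE.
have mwfst : measurable_fun (O' `*` I) (fun p : 'rV[R]_n * RR => (w p.1)%:E).
  apply: (measurable_comp mO' _ mwE'); first by move=> _ [p [Dp _] <-].
  by apply: measurable_funTS; exact: measurable_fst.
have mO'I : measurable (O' `*` I : set ('rV[R]_n * RR)) by exact: measurableX.
have R1 : \int[nu]_(p in O `*` J) (w (upd i p.2 p.1))%:E =
    (\int[mu]_(x in O') (w x)%:E) * (b i - a i)%:E.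
  rewrite -swapr_half.
  have := @ge0_integral_swapr R n i (O' `*` I) _ mO'I mwfst _.
  move=> ->; last by move=> p _; rewrite lee_fin.
  apply: (etrans (ge0_integral_fst mu lam mO' mI mwE' (w0E O'))).
  by congr (_ * _).
have m1A : measurable_fun O (fun x => 1 + 2%:E * A x).
  by apply: emeasurable_funD => //; exact: measurable_funeM.
have R2 : \int[nu]_(p in O `*` J) (1 + 2%:E * A p.1) =
    (mu O + 2%:E * ((b i - a i)%:E * \int[mu]_(x in O) (v x)%:E)) * (b' i - a' i)%:E.
  have p0 x : O x -> 0 <= 1 + 2%:E * A x.
    by move=> Ox; rewrite adde_ge0// mule_ge0// A0.
  apply: (etrans (ge0_integral_fst mu lam mO mJ m1A p0)).
  congr (_ * _) => //; rewrite ge0_integralD//; last 2 first.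
  - by move=> x Ox; rewrite mule_ge0// A0.
  - exact: measurable_funeM.
  by rewrite integral_cst// mul1e ge0_integralZl// EA.
have mwupd : measurable_fun (O `*` J) (fun p : 'rV[R]_n * RR => (w (upd i p.2 p.1))%:E).
  by have := measurable_fun_swapr (i := i) mO'I mwfst; rewrite swapr_half.
have m1A' : measurable_fun (O `*` J) (fun p : 'rV[R]_n * RR => 1 + 2%:E * A p.1).
  apply: (measurable_comp mO _ m1A); first by move=> _ [p [Dp _] <-].
  by apply: measurable_funTS; exact: measurable_fst.
have mwfst' : measurable_fun (O `*` J) (fun p : 'rV[R]_n * RR => (w p.1)%:E).
  apply: (measurable_comp mO _ mwE); first by move=> _ [p [Dp _] <-].
  by apply: measurable_funTS; exact: measurable_fst.
have A0' (p : 'rV[R]_n * RR) : (O `*` J) p -> 0 <= 1 + 2%:E * A p.1.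
  by move=> [Op _]; rewrite adde_ge0// mule_ge0// A0.
have : \int[nu]_(p in O `*` J) (w p.1)%:E <=
    \int[nu]_(p in O `*` J) ((w (upd i p.2 p.1))%:E + (1 + 2%:E * A p.1)).
  apply: (ae_ge0_le_integral mOJ _ mwfst') => //.
  - by move=> p _; rewrite lee_fin.
  - by move=> p Op; apply: adde_ge0; [rewrite lee_fin|exact: A0'].
  - exact: emeasurable_funD.
  by apply: filterS H => p Hp [Op Jp]; apply: Hp; split => //; exact: JI.
rewrite ge0_integralD//; last by move=> p _; rewrite lee_fin.
(* The length of [J] is cancelled; the side [I], twice as long, leaves the coefficient 2 in front of
   the integral over [O']. *)
rewrite L R1 R2 half => LE.
rewrite -(@lee_pmul2r _ (b' i - a' i)%:E)//.
apply: (le_trans LE).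
set x := \int[mu]_(x in O') (w x)%:E.
have x0 : 0 <= x by apply: integral_ge0 => ? _; rewrite lee_fin.
have -> : x * (2 * (b' i - a' i))%:E = 2%:E * x * (b' i - a' i)%:E.
  by rewrite EFinM muleA (muleC x).
rewrite [leRHS]ge0_muleDl ?mule_ge0//.
apply: adde_ge0 => //; apply: mule_ge0 => //; apply: mule_ge0.
  by rewrite lee_fin mulr_ge0// ltW.
by apply: integral_ge0 => ? Ox; rewrite lee_fin v0.
Qed.

End halving.

(** * Iterated halving of cubes *)

Section cubes.
Context (R : realType) (n : nat).
Notation RR := (measurableTypeR R).
Notation mu := (lebesgue_row R n).
Notation lam := (@lebesgue_measure R).
Notation nu := (mu \x lam)%E.
Implicit Types (c : 'rV[R]_n) (r : R).

Definition cube c r : set 'rV[R]_n :=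
  obox (fun j => c ord0 j - r) (fun j => c ord0 j + r).

Lemma measurable_cube c r : measurable (cube c r).
Proof. exact: measurable_obox. Qed.

Lemma subset_cube c r s : r <= s -> cube c r `<=` cube c s.
Proof.
move=> rs x xr j; have := xr j; rewrite /= !in_itv /= => /andP[x1 x2].
by rewrite (le_lt_trans _ x1) ?lerB// (lt_le_trans x2)// lerD2l.
Qed.

Lemma lebesgue_cube c r : 0 < r -> mu (cube c r) = ((2 * r) ^+ n)%:E.
Proof.
move=> r0; rewrite /cube /obox lebesgue_row_boxset; last by move=> j; exact: measurable_itv.
rewrite (eq_bigr (fun=> (2 * r)%:E)); last first.
  move=> j _; rewrite lebesgue_measure_itv /= lte_fin ifT; last lra.
  by rewrite -EFinD; congr EFin; lra.
by rewrite prodEFin prodr_const card_ord.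
Qed.

Section iteration.
Variables (c : 'rV[R]_n) (r0 K : R) (v : 'rV[R]_n -> R).
Hypotheses (r00 : 0 < r0) (n0 : (0 < n)%N).
Hypotheses (intv : mu.-integrable (cube c r0) (EFin \o v))
  (v0 : forall x, cube c r0 x -> 0 <= v x)
  (vK : (\int[mu]_(x in cube c r0) (v x ^+ n)%:E <= K%:E)%E).

Let mv : measurable_fun (cube c r0) v.
Proof. by apply/measurable_EFinP; exact: measurable_int intv. Qed.

Let K0 : 0 <= K.
Proof.
rewrite -lee_fin; apply: le_trans vK; apply: integral_ge0 => x Qx.
by rewrite lee_fin exprn_ge0// v0.
Qed.

Lemma scaled_potential r : 0 < r -> r <= r0 ->
  (r%:E * \int[mu]_(x in cube c r) (v x)%:E <= ((2 * r) ^+ n * (1 + K))%:E)%E.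
Proof.
move=> rp rr0; have mQ := measurable_cube c r; have QQ0 := @subset_cube c _ _ rr0.
have v0r x : cube c r x -> 0 <= v x by move=> /QQ0; exact: v0.
have mvr : measurable_fun (cube c r) v by exact: (measurable_funS (measurable_cube c r0) QQ0 mv).
have mvn : measurable_fun (cube c r) (fun x => (v x ^+ n)%:E).
  by apply/measurable_EFinP; exact: measurable_funX.
have mvE : measurable_fun (cube c r) (fun x => (v x)%:E) by exact/measurable_EFinP.
rewrite -ge0_integralZl//; last by rewrite lee_fin ltW.
apply: (@le_trans _ _ (\int[mu]_(x in cube c r) (1 + (r ^+ n)%:E * (v x ^+ n)%:E))%E).
  apply: ge0_le_integral => //.
  - by move=> x Qx; rewrite -EFinM lee_fin mulr_ge0 ?v0r// ltW.
  - exact: measurable_funeM.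
  - by apply: emeasurable_funD => //; exact: measurable_funeM.
  - move=> x Qx; rewrite -!EFinM -EFinD lee_fin -exprMn.
    have rv : 0 <= r * v x by rewrite mulr_ge0 ?v0r// ltW.
    have [le1|gt1] := leP (r * v x) 1; first by rewrite ler_wpDr// exprn_ge0.
    by apply: ler_wpDl => //; rewrite ler_eXnr// ltW.
rewrite ge0_integralD//; last 2 first.
- by move=> x Qx; rewrite -EFinM lee_fin mulr_ge0 ?exprn_ge0 ?v0r// ltW.
- exact: measurable_funeM.
have -> : (\int[mu]_(x in cube c r) 1 = ((2 * r) ^+ n)%:E)%E.
  by rewrite integral_cst// mul1e; exact: lebesgue_cube.
rewrite ge0_integralZl//; last 2 first.
- by move=> x Qx; rewrite lee_fin exprn_ge0// v0r.
- by rewrite lee_fin exprn_ge0// ltW.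
rewrite mulrDr mulr1 EFinD leeD2l// EFinM.
(* The factor [r ^+ n] is enlarged to [(2 * r) ^+ n], the volume of the cube, to match the other
   term. *)
apply: lee_pmul.
- by rewrite lee_fin exprn_ge0// ltW.
- by apply: integral_ge0 => x Qx; rewrite lee_fin exprn_ge0// v0r.
- by rewrite lee_fin lerXn2r ?nnegrE ?mulr_ge0 ?ltW// ltr_pMl// ltr1n.
- apply: le_trans vK; apply: ge0_subset_integral => //.
  + exact: measurable_cube.
  + by apply/measurable_EFinP; exact: measurable_funX.
  + by move=> x Qx; rewrite lee_fin exprn_ge0// v0.
Qed.

Variable w : 'rV[R]_n -> R.
Hypotheses (mw : measurable_fun (cube c r0) w) (w0 : forall x, 0 <= w x).
Hypothesis Hw : forall a b i, obox a b `<=` cube c r0 ->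
  {ae nu, forall p, (obox a b `*` (`]a i, b i[%classic : set RR)) p ->
    ((w p.1)%:E <= (w (upd i p.2 p.1))%:E +
      (1 + 2%:E * \int[lam]_(s in (`]a i, b i[%classic : set RR)) (v (upd i s p.1))%:E))%E}.

(* The cube whose first [k] sides have been halved. *)
Let partial_cube (k : nat) r := obox
  (fun j : 'I_n => c ord0 j - (if (j < k)%N then r / 2 else r))
  (fun j : 'I_n => c ord0 j + (if (j < k)%N then r / 2 else r)).

Let partial_cube_sub k r : 0 < r -> partial_cube k r `<=` cube c r.
Proof.
move=> rp x xr j; have := xr j; rewrite /= !in_itv /= => /andP[x1 x2].
have h : (if (j < k)%N then r / 2 else r) <= r by case: ifP => // _; lra.
by rewrite (le_lt_trans _ x1) ?lerB// (lt_le_trans x2)// lerD2l.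
Qed.

Local Open Scope ereal_scope.
Local Notation W r := (\int[mu]_(x in cube c r) (w x)%:E).

(** The [n] sides, of length [2 * r], are halved in turn. Each halving costs the volume plus [4 * r]
    times the integral of [v]; by [scaled_potential] this is at most
    [(2 * r) ^+ n * (1 + 4 * (1 + K))], hence [5 + 4 * K]. *)
Lemma cube_halving r : (0 < r)%R -> (r <= r0)%R ->
  W r <= (2 ^+ n)%:E * (W (r / 2) + ((2 * r) ^+ n * (5 + 4 * K))%:E).
Proof.
move=> rp rr0; have QQ0 := @subset_cube c _ _ rr0.
set E := ((2 * r) ^+ n * (5 + 4 * K))%:E.
have E0 : 0 <= E by rewrite lee_fin mulr_ge0 ?exprn_ge0 ?addr_ge0 ?mulr_ge0// ltW.
pose Y k := \int[mu]_(x in partial_cube k r) (w x)%:E.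
have -> : W (r / 2) = Y n.
  by congr integral; rewrite /partial_cube /cube; congr obox; apply/funext => j; rewrite ltn_ord.
have Y0 : W r = Y 0%N by [].
(* With [E] inside the parenthesis the induction closes: [Y k <= 2 Y k.+1 + E] gives
   [Y k + E <= 2 (Y k.+1 + E)]. *)
suff H k : (k <= n)%N -> W r <= (2 ^+ k)%:E * (Y k + E) by exact: H.
elim: k => [_|k IH kn]; first by rewrite expr0 mul1e Y0 leeDl.
apply: (le_trans (IH (ltnW kn))).
rewrite exprSr EFinM -muleA lee_wpmul2l ?lee_fin ?exprn_ge0//.
pose i := Ordinal kn.
have PQ := subset_trans (@partial_cube_sub k _ rp) QQ0.
have ne (j : 'I_n) : j != i -> (j < k.+1)%N = (j < k)%N.
  by move=> ji; rewrite ltnS leq_eqVlt -[k]/(nat_of_ord i) (inj_eq val_inj) (negbTE ji).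
pose rad m (j : 'I_n) := (if (j < m)%N then r / 2 else r)%R.
have radk : rad k i = r by rewrite /rad ltnn.
have radk1 : rad k.+1 i = (r / 2)%R by rewrite /rad ltnSn.
have h1 j : j != i -> (c ord0 j - rad k.+1 j = c ord0 j - rad k j)%R.
  by move=> /ne ji; rewrite /rad ji.
have h2 j : j != i -> (c ord0 j + rad k.+1 j = c ord0 j + rad k j)%R.
  by move=> /ne ji; rewrite /rad ji.
have h3 : (c ord0 i - rad k i <= c ord0 i - rad k.+1 i)%R by rewrite radk radk1; lra.
have h4 : (c ord0 i + rad k.+1 i <= c ord0 i + rad k i)%R by rewrite radk radk1; lra.
have h5 : (c ord0 i - rad k.+1 i < c ord0 i + rad k.+1 i)%R by rewrite radk1; lra.
have h6 : (c ord0 i + rad k i - (c ord0 i - rad k i) =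
    2 * (c ord0 i + rad k.+1 i - (c ord0 i - rad k.+1 i)))%R.
  by rewrite radk radk1; lra.
have mP := measurable_obox (fun j => c ord0 j - rad k j)%R (fun j => c ord0 j + rad k j)%R.
have mQ0 := measurable_cube c r0.
have mwP := measurable_funS mQ0 PQ mw.
have intvP := integrableS mQ0 mP PQ intv.
have v0P x : partial_cube k r x -> (0 <= v x)%R by move=> /PQ; exact: v0.
have BH := @box_halving R n i _ _ _ _ h1 h2 h3 h4 h5 h6 w v mwP w0 intvP v0P (Hw i PQ).
have err : mu (partial_cube k r) + 2%:E * ((c ord0 i + rad k i - (c ord0 i - rad k i))%:E *
    \int[mu]_(x in partial_cube k r) (v x)%:E) <= E.
  have -> : E = ((2 * r) ^+ n)%:E + 4%:E * ((2 * r) ^+ n * (1 + K))%:E.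
    by rewrite -EFinM -EFinD; congr EFin; ring.
  apply: leeD.
    have <- : mu (cube c r) = ((2 * r) ^+ n)%:E by exact: lebesgue_cube.
    apply: le_measure; rewrite ?inE; [exact: mP|exact: measurable_cube|].
    exact: partial_cube_sub.
  have -> : (c ord0 i + rad k i - (c ord0 i - rad k i) = 2 * r)%R by rewrite radk; ring.
  rewrite muleA -EFinM (_ : 2 * (2 * r) = 4 * r)%R; last by ring.
  rewrite EFinM -muleA lee_wpmul2l ?lee_fin//.
  apply: le_trans (scaled_potential rp rr0).
  apply: lee_wpmul2l; first by rewrite lee_fin ltW.
  apply: ge0_subset_integral => //.
  - exact: measurable_cube.
  - by apply/measurable_EFinP; exact: (measurable_funS mQ0 QQ0 mv).
  - by move=> x Qx; rewrite lee_fin v0//; exact: QQ0.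
  - exact: partial_cube_sub.
apply: (@le_trans _ _ (2%:E * Y k.+1 + E + E)).
  rewrite leeD2r//; apply: (le_trans BH); exact: leeD2l.
have Yk0 : 0 <= Y k.+1 by apply: integral_ge0 => x _; rewrite lee_fin.
move: (Y k.+1) Yk0 => y y0.
rewrite ge0_muleDr// -addeA leeD2l// /E -EFinM -EFinD lee_fin.
by rewrite le_eqVlt; apply/orP; left; apply/eqP; ring.
Qed.

(** At scale [k] the error carries the factor [2 ^+ (n * k)] and the volume
    [(2 * r0 / 2 ^+ k) ^+ n]. The powers of 2 cancel, so all scales contribute equally. *)
Lemma cube_iteration k :
  W r0 <= (2 ^+ (n * k))%:E * W (r0 / 2 ^+ k) +
    (k%:R * (2 ^+ n * (2 * r0) ^+ n * (5 + 4 * K)))%:E.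
Proof.
elim: k => [|k IH]; first by rewrite muln0 expr0 divr1 mul1e mul0r adde0.
apply: (le_trans IH).
have p2 : (0 < 2 ^+ k :> R)%R by rewrite exprn_gt0.
have rk0 : (0 < r0 / 2 ^+ k)%R by rewrite divr_gt0.
have rkr : (r0 / 2 ^+ k <= r0)%R.
  rewrite ler_pdivrMr//; apply: ler_peMr; first exact: ltW.
  by apply: exprn_ege1; rewrite ler1n.
have H := cube_halving rk0 rkr.
have E2 : (r0 / 2 ^+ k / 2 = r0 / 2 ^+ k.+1)%R by rewrite exprSr invfM mulrA.
rewrite E2 in H.
have e0 : 0 <= (2 ^+ (n * k) : R)%:E by rewrite lee_fin exprn_ge0.
apply: (le_trans (leeD2r _ (lee_wpmul2l e0 H))).
rewrite muleA -EFinM -exprD mulnS addnC ge0_muleDr; last 2 first.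
- by apply: integral_ge0 => x _; rewrite lee_fin.
- by rewrite lee_fin mulr_ge0 ?exprn_ge0 ?addr_ge0 ?mulr_ge0 ?divr_ge0// ltW.
rewrite -addeA leeD2l// -EFinM -EFinD lee_fin -[k.+1%:R]natr1.
rewrite [leRHS]mulrDl mul1r [leRHS]addrC lerD2r.
rewrite exprD le_eqVlt; apply/orP; left; apply/eqP.
rewrite [((2 * (_ / _)) ^+ n)%R]exprMn [((2 * r0) ^+ n)%R]exprMn expr_div_n -exprM (mulnC k).
have : (2 ^+ (n * k) != 0 :> R)%R by rewrite expf_neq0.
by set A := (2 ^+ (n * k))%R => A0; field.
Qed.

End iteration.
End cubes.

(** * Vanishing of the solution *)

(** Dividing by [k] and letting it grow leaves [s * N * ln 2 <= D] for every [N]. Only [C] and [k0]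
    may depend on [N]; [s] will be the measure of a superlevel set. *)
Lemma linear_growth_contradiction (R : realType) (s l D : R) : 0 <= s ->
  (forall N : nat, exists C k0, forall k : nat, (k0 <= k)%N ->
     s * (l + (N * k)%:R * ln 2) <= C + k%:R * D) -> s = 0.
Proof.
move=> s0 H; apply/eqP; rewrite eq_le s0 andbT leNgt; apply/negP => sp.
have ln20 : 0 < ln 2 :> R by rewrite ln_gt0// ltr1n.
have sl : 0 < s * ln 2 by rewrite mulr_gt0.
(* This [N] makes the left slope at least [D + 1]. The inequality then forces [k <= C - s * l],
   which the choice of [k] below refutes. *)
pose N := Num.bound `|(D + 1) / (s * ln 2)|.
have NB : (D + 1) <= N%:R * (s * ln 2).
  rewrite -ler_pdivrMr//; apply: ltW; apply: le_lt_trans (ler_norm _) _.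
  exact: archi_boundP (normr_ge0 _).
have [C [k0 Hk]] := H N.
pose k := maxn k0 (Num.bound `|C - s * l|).+1.
have kk : C - s * l < k%:R.
  apply: le_lt_trans (ler_norm _) _.
  apply: lt_le_trans (archi_boundP (normr_ge0 _)) _; rewrite ler_nat.
  by rewrite /k; apply: leq_trans (leq_maxr _ _).
have := Hk k (leq_maxl _ _); rewrite natrM.
have : (D + 1) * k%:R <= N%:R * (s * ln 2) * k%:R by rewrite ler_wpM2r.
move: kk; set kr := k%:R; set Nr := N%:R; nra.
Qed.

Section vanishing.
Context (R : realType) (n M : nat).
Notation RR := (measurableTypeR R).
Notation mu := (lebesgue_row R n).
Notation lam := (@lebesgue_measure R).
Notation nu := (mu \x lam)%E.
Variables (c : 'rV[R]_n) (r0 K : R).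
Notation Q := (cube c r0).
Variables (F : 'I_M -> 'rV[R]_n -> R) (G : 'I_n -> 'I_M -> 'rV[R]_n -> R)
  (v : 'rV[R]_n -> R).
Hypotheses (r00 : 0 < r0) (n0 : (0 < n)%N).
Hypotheses (intF : forall k, mu.-integrable Q (EFin \o F k))
  (intG : forall i k, mu.-integrable Q (EFin \o G i k))
  (intv : mu.-integrable Q (EFin \o v)) (v0 : forall x, Q x -> 0 <= v x)
  (vK : (\int[mu]_(x in Q) (v x ^+ n)%:E <= K%:E)%E).
Hypothesis weak : forall a b, obox a b `<=` Q -> forall i k rho,
  (forall j, smooth1 (rho j)) ->
  (forall j t, t \notin `]a j, b j[ -> rho j t = 0) ->
  (\int[mu]_(x in obox a b) (F k x * partial i (prodf rho) x)%:E =
   - \int[mu]_(x in obox a b) (G i k x * prodf rho x)%:E)%E.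
Local Notation U x := (\sum_k `|F k x|).
Hypothesis Gv : forall i, {ae mu, forall x, Q x -> \sum_k `|G i k x| <= v x * U x}.

Let U0 x : 0 <= U x. Proof. exact: sumr_ge0. Qed.

Let mQ : measurable Q. Proof. exact: measurable_cube. Qed.

Let mF k : measurable_fun Q (F k).
Proof. by apply/measurable_EFinP; exact: measurable_int (intF k). Qed.

Let mU : measurable_fun Q (fun x => U x).
Proof. by apply: measurable_sum => k; apply: measurableT_comp (mF k). Qed.

Section log.
Variable eps : R.
Hypothesis eps0 : 0 < eps.

Let w x := ln (1 + U x / eps).

Lemma log_ge0 x : 0 <= w x.
Proof. by rewrite ln_ge0// lerDl divr_ge0// ltW. Qed.

Lemma measurable_log : measurable_fun Q w.
Proof.
apply: (measurableT_comp (@measurable_ln R)).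
by apply: measurable_funD => //; apply: measurable_funM.
Qed.

Lemma log_harnack_line a b i : obox a b `<=` Q ->
  {ae nu, forall p, (obox a b `*` (`]a i, b i[%classic : set RR)) p ->
    ((w p.1)%:E <= (w (upd i p.2 p.1))%:E +
      (1 + 2%:E * \int[lam]_(s in (`]a i, b i[%classic : set RR)) (v (upd i s p.1))%:E))%E}.
Proof.
move=> abQ; have mO := measurable_obox a b.
have intvO := integrableS mQ mO abQ intv.
have gvO : {ae mu, forall x, obox a b x -> \sum_k `|G i k x| <= v x * U x}.
  by apply: filterS (Gv i) => x Gx /abQ; exact: Gx.
have HL := @harnack_line R n M i a b F (G i) v
  (fun k => integrableS mQ mO abQ (intF k)) (fun k => integrableS mQ mO abQ (intG i k))
  intvO (fun x xO => v0 (abQ x xO)) (weak abQ i) gvO.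
have HI := ae_fst (ae_integrable_rectangle mO (measurable_side i a b)
  (integrable_obox_upd i intvO)).
have nuF : Filter (almost_everywhere nu) by exact: ae_filter_ringOfSetsType.
have HLI := @filterI _ _ nuF _ _ HL HI.
move: HLI; apply: (@filterS _ _ nuF) => -[x t] /= [H I2] xt.
have Ox : obox a b x by case: xt.
have {}I2 := I2 Ox.
have {}H := H xt.
have [A EA [A0 HA]] : exists2 A : R,
    (\int[lam]_(s in (`]a i, b i[%classic : set RR)) (v (upd i s x))%:E = A%:E)%E &
    0 <= A /\ (forall N, 2 * A <= N.+1%:R -> U x <= 2 ^+ N.+1 * U (upd i t x)).
  exists (\int[lam]_(s in (`]a i, b i[%classic : set RR)) v (upd i s x)).
    by rewrite /Rintegral fineK//; exact: (integrable_fin_num (measurable_side i a b) I2).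
  split; last exact: H.
  apply: Rintegral_ge0 => s Is; apply: v0; apply: abQ.
  by apply/boxset_upd; split => // j _; exact: Ox.
by rewrite EA -EFinM -!EFinD lee_fin addrA; exact: ln_harnack.
Qed.

Lemma log_iteration k :
  (\int[mu]_(x in Q) (w x)%:E <=
   (2 ^+ (n * k))%:E * \int[mu]_(x in cube c (r0 / 2 ^+ k)) (w x)%:E +
    (k%:R * (2 ^+ n * (2 * r0) ^+ n * (5 + 4 * K)))%:E)%E.
Proof.
exact: (cube_iteration r00 n0 intv v0 vK measurable_log log_ge0 log_harnack_line).
Qed.

(** From [ln (1 + z) <= z <= 1 + z ^+ 2]; the square is what the [L^2] form of vanishing
    controls. *)
Lemma log_cube_le r B : 0 < r -> r <= r0 ->
  (\int[mu]_(x in cube c r) (U x ^+ 2)%:E <= B%:E)%E ->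
  (\int[mu]_(x in cube c r) (w x)%:E <= ((2 * r) ^+ n + eps ^- 2 * B)%:E)%E.
Proof.
move=> rp rr0 UB; have mr := measurable_cube c r.
have rQ := @subset_cube R n c _ _ rr0.
have mUr : measurable_fun (cube c r) (fun x => (U x ^+ 2)%:E).
  by apply/measurable_EFinP; apply: measurable_funX; exact: (measurable_funS mQ rQ mU).
have e2 : 0 <= eps ^- 2 by rewrite invr_ge0 exprn_ge0// ltW.
apply: (@le_trans _ _ (\int[mu]_(x in cube c r) (1 + (eps ^- 2)%:E * (U x ^+ 2)%:E))%E).
  apply: ge0_le_integral => //.
  - by move=> x _; rewrite lee_fin log_ge0.
  - by apply/measurable_EFinP; exact: (measurable_funS mQ rQ measurable_log).
  - by apply: emeasurable_funD => //; exact: measurable_funeM.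
  move=> x _; rewrite -EFinM -EFinD lee_fin.
  have z0 : 0 <= U x / eps by rewrite divr_ge0// ltW.
  apply: (@le_trans _ _ (U x / eps)).
    by apply: le_ln1Dx; apply: lt_le_trans z0; rewrite ltrN10.
  have -> : eps ^- 2 * U x ^+ 2 = (U x / eps) ^+ 2 by rewrite exprMn exprVn mulrC.
  by nra.
rewrite ge0_integralD//; last 2 first.
- by move=> x _; rewrite -EFinM lee_fin mulr_ge0// sqr_ge0.
- exact: measurable_funeM.
have -> : (\int[mu]_(x in cube c r) 1 = ((2 * r) ^+ n)%:E)%E.
  by rewrite integral_cst// mul1e; exact: lebesgue_cube.
rewrite ge0_integralZl//; last by move=> x _; rewrite lee_fin sqr_ge0.
rewrite EFinD leeD2l// EFinM; apply: lee_wpmul2l => //.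
Qed.

(** Markov's inequality, as [w >= ln (d / eps)] where [U >= d]. If that logarithm is nonpositive, so
    is the left-hand side. *)
Lemma log_superlevel (d : R) : 0 < d ->
  (mu (Q `&` [set x | (d <= U x)%R]) * (ln (d / eps))%:E <= \int[mu]_(x in Q) (w x)%:E)%E.
Proof.
move=> d0; set S := Q `&` _.
have mS : measurable S.
  have -> : S = Q `&` (fun x => U x) @^-1` `[d, +oo[%classic.
    by apply/seteqP; split => x [Qx] /=; rewrite in_itv /= andbT.
  by apply: mU => //; exact: measurable_itv.
have mwE : measurable_fun Q (fun x => (w x)%:E) by apply/measurable_EFinP; exact: measurable_log.
have [l0|l0] := leP (ln (d / eps)) 0.
  apply: (@le_trans _ _ 0%E); last by apply: integral_ge0 => x _; rewrite lee_fin log_ge0.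
  by rewrite mule_ge0_le0.
apply: (@le_trans _ _ (\int[mu]_(x in S) (w x)%:E)%E); last first.
  apply: ge0_subset_integral => //; last exact: subIsetl.
  by move=> x _; rewrite lee_fin log_ge0.
have -> : (mu S * (ln (d / eps))%:E = \int[mu]_(x in S) cst (ln (d / eps))%:E x)%E.
  by rewrite integral_cst// muleC.
apply: ge0_le_integral => //.
- by move=> x _; rewrite lee_fin ltW.
- exact: (measurable_funS mQ (@subIsetl _ _ _) mwE).
move=> x [_ /= dU].
have p1 : 0 < 1 + U x / eps by rewrite ltr_wpDr// divr_ge0// ltW.
have p2 : 0 < d / eps by rewrite divr_gt0.
rewrite lee_fin ler_ln ?posrE//.
by apply: ler_wpDl => //; rewrite ler_pM2r ?invr_gt0.
Qed.

End log.

Lemma superlevel_null (d : R) : 0 < d ->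
  (forall m : nat, exists2 rho, 0 < rho & forall r, 0 < r < rho -> r <= r0 ->
     (\int[mu]_(x in cube c r) (U x ^+ 2)%:E <= (r ^+ m)%:E)%E) ->
  mu (Q `&` [set x | d <= U x]) = 0.
Proof.
move=> d0 flat.
set S := Q `&` _.
have muQ : mu Q = ((2 * r0) ^+ n)%:E by exact: lebesgue_cube.
have mS : measurable S.
  have -> : S = Q `&` (fun x => U x) @^-1` `[d, +oo[%classic.
    by apply/seteqP; split => x [Qx] /=; rewrite in_itv /= andbT.
  by apply: mU => //; exact: measurable_itv.
have Sfin : mu S \is a fin_num.
  rewrite ge0_fin_numE//; apply: (@le_lt_trans _ _ (mu Q)); last by rewrite muQ ltry.
  by apply: le_measure; rewrite ?inE//; exact: subIsetl.
suff : fine (mu S) = 0 by move=> S0; rewrite -(fineK Sfin) S0.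
apply: (@linear_growth_contradiction _ _ (ln d) (2 ^+ n * (2 * r0) ^+ n * (5 + 4 * K))).
  by rewrite fine_ge0.
(* Order [n] pays for the factor [2 ^+ (n * k)] of the iteration, order [2 * N] for [eps ^- 2],
   equal to [2 ^+ (2 * N * k)]. The remainder is the constant given next, independent of [k]. *)
move=> N; have [rho rho0 Hrho] := flat (n + 2 * N)%N.
have p2 k : (0 : R) < 2 ^+ k by rewrite exprn_gt0.
(* The second witness ensures [r0 / 2 ^+ k < rho], through [k < 2 ^+ k]. *)
exists ((2 * r0) ^+ n + r0 ^+ (n + 2 * N)), (Num.bound `|r0 / rho|) => k kk.
have kb : r0 / 2 ^+ k < rho.
  rewrite ltr_pdivrMr// -ltr_pdivrMl// mulrC.
  apply: (le_lt_trans (ler_norm _)); apply: (lt_le_trans (archi_boundP (normr_ge0 _))).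
  apply: (@le_trans _ _ k%:R); first by rewrite ler_nat.
  by rewrite -natrX ler_nat ltnW// ltn_expl.
have rk0 : 0 < r0 / 2 ^+ k by rewrite divr_gt0.
have rkr : r0 / 2 ^+ k <= r0.
  rewrite ler_pdivrMr//; apply: ler_peMr; first exact: ltW.
  by apply: exprn_ege1; rewrite ler1n.
pose eps : R := (2 ^+ (N * k))^-1.
have eps0 : 0 < eps by rewrite invr_gt0.
have A1 := log_superlevel eps0 d0.
have A2 := log_iteration eps0 k.
have A3 := log_cube_le eps0 rk0 rkr (Hrho _ _ rkr).
have {}A3 : (\int[mu]_(x in cube c (r0 / 2 ^+ k)) (ln (1 + U x / eps))%:E <=
    ((2 * (r0 / 2 ^+ k)) ^+ n + eps ^- 2 * (r0 / 2 ^+ k) ^+ (n + 2 * N))%:E)%E.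
  by apply: A3; rewrite rk0.
have e0 : (0 <= (2 ^+ (n * k) : R)%:E)%E by rewrite lee_fin ltW.
have := le_trans A1 (le_trans A2 (leeD2r _ (lee_wpmul2l e0 A3))).
rewrite -/S -(fineK Sfin) -!EFinM -EFinD lee_fin /=.
have -> : ln (d / eps) = ln d + (N * k)%:R * ln 2.
  by rewrite /eps invrK lnM ?posrE// lnXn// mulr_natl.
rewrite (_ : 2 ^+ (n * k) * _ = (2 * r0) ^+ n + r0 ^+ (n + 2 * N))//.
have An : (2 ^+ k) ^+ n != 0 :> R by rewrite expf_neq0// gt_eqF.
have AN : (2 ^+ k) ^+ N != 0 :> R by rewrite expf_neq0// gt_eqF.
have -> : eps ^- 2 = ((2 ^+ k) ^+ N) ^+ 2.
  by rewrite -exprVn /eps invrK mulnC exprM.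
have -> : (2 : R) ^+ (n * k) = (2 ^+ k) ^+ n by rewrite mulnC exprM.
rewrite [(2 * (r0 / _)) ^+ n]exprMn [(2 * r0) ^+ n]exprMn !expr_div_n.
rewrite mul2n -addnn !exprD.
by field; rewrite An AN.
Qed.

Lemma sum_norm_eq0_ae :
  (forall m : nat, exists2 rho, 0 < rho & forall r, 0 < r < rho -> r <= r0 ->
     (\int[mu]_(x in cube c r) (U x ^+ 2)%:E <= (r ^+ m)%:E)%E) ->
  {ae mu, forall x, Q x -> U x = 0}.
Proof.
move=> flat.
have H (m : nat) : {ae mu, forall x, Q x -> U x < m.+1%:R^-1}.
  exists (Q `&` [set x | m.+1%:R^-1 <= U x]); split.
  - rewrite (_ : [set x | _] = (fun x => U x) @^-1` `[m.+1%:R^-1, +oo[%classic).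
      by apply: mU => //; exact: measurable_itv.
    by apply/seteqP; split => x /=; rewrite in_itv /= andbT.
  - by apply: superlevel_null flat; rewrite invr_gt0.
  - by move=> x /= /not_implyP[Qx /negP]; rewrite -leNgt.
have muF : Filter (almost_everywhere mu) by exact: ae_filter_ringOfSetsType.
have {}H := ae_foralln H.
move: H; apply: (@filterS _ _ muF) => x Hx Qx; apply/eqP; rewrite eq_le U0 andbT leNgt.
apply/negP => Ux.
have := Hx (Num.bound (U x)^-1) Qx; apply/negP; rewrite -leNgt.
rewrite invf_ple ?posrE//; apply: le_trans (ltW (archi_boundP _)) _.
  by rewrite invr_ge0 U0.
by rewrite ler_nat.
Qed.

End vanishing.

(** * Euclidean norm against the sum of moduli *)

Section enorm.
Context {R : realType}.

Lemma enorm_ge0 p q (A : 'M[R]_(p, q)) : 0 <= enorm A.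
Proof. exact: sqrtr_ge0. Qed.

Lemma enorm_sqr p q (A : 'M[R]_(p, q)) :
  enorm A ^+ 2 = \sum_(i < p) \sum_(j < q) `|A i j| ^+ 2.
Proof.
by rewrite sqr_sqrtr//; apply: sumr_ge0 => ? _; apply: sumr_ge0 => ? _; rewrite sqr_ge0.
Qed.

Lemma norm_le_enorm p q (A : 'M[R]_(p, q)) i j : `|A i j| <= enorm A.
Proof.
rewrite -(@ler_pXn2r _ 2)// ?nnegrE ?enorm_ge0// enorm_sqr.
rewrite (bigD1 i)//= (bigD1 j)//= -addrA lerDl addr_ge0//.
  by apply: sumr_ge0 => ? _; rewrite sqr_ge0.
by apply: sumr_ge0 => ? _; apply: sumr_ge0 => ? _; rewrite sqr_ge0.
Qed.

Lemma enorm_row_le q (x : 'rV[R]_q) : enorm x <= \sum_j `|x ord0 j|.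
Proof.
rewrite -(@ler_pXn2r _ 2)// ?nnegrE ?enorm_ge0 ?sumr_ge0// enorm_sqr big_ord1.
rewrite expr2 mulr_suml; apply: ler_sum => j _; rewrite expr2 ler_wpM2l//.
by rewrite (bigD1 j)//= lerDl sumr_ge0.
Qed.

Lemma enorm_row_ge q (x : 'rV[R]_q) : \sum_j `|x ord0 j| <= q%:R * enorm x.
Proof.
apply: (@le_trans _ _ (\sum_(j < q) enorm x)).
  by apply: ler_sum => j _; exact: norm_le_enorm.
by rewrite sumr_const card_ord mulr_natl.
Qed.

End enorm.

(** Endpoints are included: [f] vanishes at [t] and on one whole side of it, and the derivative,
    which exists, can be computed along a sequence from that side. *)
Lemma derive1_eq0 {R : realType} (f : R -> R) (a b t : R) : smooth1 f ->
  (forall s, s \notin `]a, b[ -> f s = 0) -> t \notin `]a, b[ -> derive1 f t = 0.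
Proof.
move=> /smooth1_derive[df _] f0 tab; rewrite derive1E.
have [dft _] := df t; have {}dft : (fun h => h^-1 *: (f (h *: 1 + t) - f t)) @ 0^' --> 'D_1 f t.
  exact: dft.
have ft : f t = 0 by exact: f0.
have key (u : nat -> R) :
    (u m)^-1 *: (f (u m *: 1 + t) - f t) @[m --> \oo] --> 'D_1 f t ->
    (forall m, f (u m + t) = 0) -> 'D_1 f t = 0.
  move=> H fu0; rewrite -(cvg_lim _ H)//; apply: cvg_lim => //.
  under eq_fun do rewrite [_ *: 1]mulr1 fu0 ft subrr scaler0.
  exact: cvg_cst.
have h0 : (fun m : nat => m.+1%:R^-1 : R) @ \oo --> (0 : R) by exact: cvg_harmonic.
move: tab; rewrite in_itv /= negb_and -!leNgt => /orP[ta|bt].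
- apply: (key (fun m => - m.+1%:R^-1)) => [|m].
  + move/cvg_dnbhs_at_left/cvg_at_leftP : dft => /(_ (fun m => - m.+1%:R^-1)); apply.
    split; first by move=> m; rewrite oppr_lt0 invr_gt0.
    by rewrite -oppr0; exact: cvgN.
  + apply: f0; rewrite in_itv /= negb_and -!leNgt (le_trans _ ta)//.
    by rewrite gerDr oppr_le0.
- apply: (key (fun m => m.+1%:R^-1)) => [|m].
  + move/cvg_dnbhs_at_right/cvg_at_rightP : dft => /(_ (fun m => m.+1%:R^-1)); apply.
    by split => // m; rewrite invr_gt0.
  + apply: f0; rewrite in_itv /= negb_and -!leNgt orbC (le_trans bt)//.
    by rewrite lerDr.
Qed.

(** * Cubes as balls of the sup norm *)

Section cubes_topology.
Context {R : realType} {n : nat}.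
Implicit Types (c x y : 'rV[R]_n) (r : R).

Lemma in_cube c r x : cube c r x <-> forall j, `|x ord0 j - c ord0 j| < r.
Proof.
split=> H j; have := H j.
  by rewrite /= in_itv /= ltr_distl.
by rewrite ltr_distl /= in_itv /=.
Qed.

Lemma cube_ball c r : 0 < r -> cube c r = ball c r.
Proof.
move=> r0; apply/seteqP; split => x.
  by move/in_cube => H; split => // i j; rewrite ord1 /ball /= distrC.
move=> [_ H]; apply/in_cube => j; have := H ord0 j.
by rewrite /ball /= distrC.
Qed.

Lemma cube_eball c r : 0 < r -> (0 < n)%N -> cube c r `<=` eball c (n%:R * r).
Proof.
move=> r0 n0 x /in_cube H; rewrite /eball /=.
apply: (le_lt_trans (enorm_row_le _)).
rewrite mulr_natl -[X in _ < _ *+ X]card_ord -sumr_const.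
apply: ltr_sum => [|j _]; last by rewrite !mxE.
by apply/hasP; exists (Ordinal n0) => //; rewrite mem_index_enum.
Qed.

End cubes_topology.

(** * Passage to Borel representatives *)

Section borel_version.
Context {R : realType} {n : nat}.
Notation mu := (lebesgue_row R n).
Implicit Types (Omega K : set 'rV[R]_n) (f g : 'rV[R]_n -> R).

Lemma borel_version Omega f : measurable Omega -> lebesgue_measurable_fun Omega f ->
  exists2 g, measurable_fun setT g & ae_eq mu Omega f g.
Proof.
move=> mO [g mg fg]; exists (g \_ Omega); first exact/(measurable_restrictT _ mO).
by apply: filterS fg => x fgx Ox; rewrite patchE mem_set// fgx.
Qed.

Lemma Lp_loc_ae_eq p Omega f g : Lp_loc p Omega f -> ae_eq mu Omega f g ->
  forall K, compact K -> K `<=` Omega -> (\int[mu]_(x in K) (`|g x| ^+ p)%:E < +oo)%E.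
Proof.
move=> [_ fp] fg K cK KO; rewrite -(@ae_eq_integral_nomeas _ _ _ mu _ (fun x => (`|f x| ^+ p)%:E)).
  exact: fp.
by apply: filterS fg => x fgx /KO/fgx ->.
Qed.

Lemma integral_support Omega K (h : 'rV[R]_n -> \bar R) : K `<=` Omega ->
  (forall x, ~ K x -> h x = 0%E) ->
  (\int[mu]_(x in Omega) h x = \int[mu]_(x in K) h x)%E.
Proof.
move=> KO h0; rewrite integral_mkcond [RHS]integral_mkcond; apply: eq_integral => x _.
rewrite !patchE; have [xK|xK] := boolP (x \in K).
  by rewrite mem_set//; apply: KO; exact: set_mem.
by rewrite h0 ?if_same//; move/mem_set; exact/negP.
Qed.

End borel_version.

Definition closed_cube {R : realType} {n : nat} (c : 'rV[R]_n) (r : R) : set 'rV[R]_n :=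
  cbox (fun j => c ord0 j - r) (fun j => c ord0 j + r).

(** * Vanishing on a cube around a point of infinite order *)

Section local_uniqueness.
Context {R : realType} {n M : nat}.
Notation mu := (lebesgue_row R n).
Variables (Omega : set 'rV[R]_n) (F : 'I_M -> 'rV[R]_n -> R)
  (G : 'I_n -> 'I_M -> 'rV[R]_n -> R) (W : 'rV[R]_n -> R).
Hypothesis n0 : (0 < n)%N.
Hypotheses (mF : forall k, measurable_fun setT (F k))
  (mG : forall i k, measurable_fun setT (G i k)) (mW : measurable_fun setT W).
Hypotheses (F1 : forall k K, compact K -> K `<=` Omega ->
    (\int[mu]_(x in K) (`|F k x| ^+ 1)%:E < +oo)%E)
  (G1 : forall i k K, compact K -> K `<=` Omega ->
    (\int[mu]_(x in K) (`|G i k x| ^+ 1)%:E < +oo)%E)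
  (Wn : forall K, compact K -> K `<=` Omega ->
    (\int[mu]_(x in K) (`|W x| ^+ n)%:E < +oo)%E).
Hypothesis weak : forall i k phi, test_function Omega phi ->
  (\int[mu]_(x in Omega) (F k x * partial i phi x)%:E =
   - \int[mu]_(x in Omega) (G i k x * phi x)%:E)%E.
Local Notation U x := (\sum_k `|F k x|).
Hypothesis GW : {ae mu, forall x, Omega x -> forall i,
  \sum_k `|G i k x| <= M%:R * `|W x| * U x}.

(** Infinite order for the Borel representatives, with cubes for Euclidean balls and explicit bounds
    for limits, as [superlevel_null] takes it. *)
Definition flat_at (c : 'rV[R]_n) := forall m : nat, exists2 rho, 0 < rho &
  forall r, 0 < r < rho -> (\int[mu]_(x in cube c r) (U x ^+ 2)%:E <= (r ^+ m)%:E)%E.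

Let integrable_cube (g : 'rV[R]_n -> R) c r p : measurable_fun setT g ->
  (\int[mu]_(x in closed_cube c r) (`|g x| ^+ p)%:E < +oo)%E ->
  mu.-integrable (cube c r) (fun x => (`|g x| ^+ p)%:E).
Proof.
move=> mg goo.
have mgp D : measurable_fun D (fun x => (`|g x| ^+ p)%:E).
  apply/measurable_EFinP; apply: measurable_funX; apply: measurableT_comp => //.
  exact: measurable_funTS mg.
apply: (integrableS (measurable_cbox _ _) (measurable_cube c r) (@obox_cbox _ _ _ _)).
apply/integrableP; split=> //; apply: le_lt_trans goo.
apply: ge0_le_integral => //.
- exact: measurable_cbox.
- exact: measurableT_comp.
- by move=> x _; rewrite lee_fin ger0_norm// exprn_ge0.
Qed.

Let integrable_cube1 (g : 'rV[R]_n -> R) c r : measurable_fun setT g ->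
  (\int[mu]_(x in closed_cube c r) (`|g x| ^+ 1)%:E < +oo)%E ->
  mu.-integrable (cube c r) (EFin \o g).
Proof.
move=> mg /(integrable_cube mg); apply: le_integrable.
- exact: measurable_cube.
- by apply/measurable_EFinP; exact: measurable_funTS mg.
- by move=> x _ /=; rewrite expr1 normr_id.
Qed.

Lemma weak_obox a b c r : closed_cube c r `<=` Omega -> obox a b `<=` cube c r ->
  forall i k rho, (forall j, smooth1 (rho j)) ->
  (forall j t, t \notin `]a j, b j[ -> rho j t = 0) ->
  (\int[mu]_(x in obox a b) (F k x * partial i (prodf rho) x)%:E =
   - \int[mu]_(x in obox a b) (G i k x * prodf rho x)%:E)%E.
Proof.
move=> crO abc i k rho srho rho0.
have [->|/set0P[x0 x0ab]] := eqVneq (obox a b) set0.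
  by rewrite !integral_set0 oppe0.
have ab j : a j < b j by have := x0ab j; rewrite /= in_itv /= => /andP[]; exact: lt_trans.
(* The support of a test function is closed, so the closed box must lie in [Omega]. If it left the
   closed cube in direction [j], some point of the nonempty open box, moved in coordinate [j] alone
   to a midpoint, would leave the cube. *)
have abO : cbox a b `<=` Omega.
  apply: subset_trans crO => x xab j.
  have cab t : t \in `]a j, b j[ -> c ord0 j - r < t < c ord0 j + r.
    move=> tab; have := abc (upd j t x0); have tO : obox a b (upd j t x0).
      by apply/boxset_upd; split => // l _; exact: x0ab.
    by move=> /(_ tO)/boxset_upd[]; rewrite /= in_itv.
  have := xab j; rewrite /= !in_itv /= => /andP[ax xb].
  apply/andP; split; [apply: le_trans ax|apply: (le_trans xb)]; rewrite leNgt; apply/negP => H.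
  - have m1 : a j < Num.min (b j) (c ord0 j - r) by rewrite lt_min ab.
    have m2 : Num.min (b j) (c ord0 j - r) <= b j by rewrite ge_min lexx.
    have m3 : Num.min (b j) (c ord0 j - r) <= c ord0 j - r by rewrite ge_min lexx orbT.
    have : (a j + Num.min (b j) (c ord0 j - r)) / 2 \in `]a j, b j[.
      by rewrite in_itv /=; apply/andP; split; lra.
    by move=> /cab /andP[? _]; lra.
  - have m1 : Num.max (a j) (c ord0 j + r) < b j by rewrite gt_max ab.
    have m2 : a j <= Num.max (a j) (c ord0 j + r) by rewrite le_max lexx.
    have m3 : c ord0 j + r <= Num.max (a j) (c ord0 j + r) by rewrite le_max lexx orbT.
    have : (b j + Num.max (a j) (c ord0 j + r)) / 2 \in `]a j, b j[.
      by rewrite in_itv /=; apply/andP; split; lra.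
    by move=> /cab /andP[_ ?]; lra.
have abO' : obox a b `<=` Omega by apply: subset_trans abO; exact: obox_cbox.
have := weak i k (test_function_prodf srho rho0 abO).
rewrite (integral_support abO'); last first.
  move=> x xab; rewrite partial_prodf// (prodf_eq0 _ xab) ?mulr0// => j t tj.
  rewrite /setf; case: eqVneq tj => [->|_] tj; last exact: rho0.
  exact: (derive1_eq0 (srho i) (rho0 i) tj).
by rewrite (integral_support abO')// => x xab; rewrite (prodf_eq0 rho0 xab) mulr0.
Qed.

Lemma local_uniqueness c r : 0 < r -> closed_cube c r `<=` Omega -> flat_at c ->
  {ae mu, forall x, cube c r x -> U x = 0}.
Proof.
move=> r0 crO flat.
have cK : compact (closed_cube c r) by exact: compact_cbox.
have crO' : cube c r `<=` Omega by apply: subset_trans crO; exact: obox_cbox.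
pose v x := M%:R * `|W x|.
have iWn := integrable_cube mW (Wn cK crO).
have mv D : measurable_fun D v.
  apply: measurable_funM => //; apply: measurableT_comp => //; exact: measurable_funTS mW.
have mQ := measurable_cube c r.
have ivn : mu.-integrable (cube c r) (fun x => (v x ^+ n)%:E).
  have := integrableZl mQ (M%:R ^+ n) iWn; apply: eq_integrable => // x _.
  by rewrite -EFinM -exprMn.
have i1 : mu.-integrable (cube c r) (cst 1%E).
  apply/integrableP; split => //; under eq_integral do rewrite abse1.
  rewrite integral_cst// mul1e.
  by rewrite [X in (X < _)%E](lebesgue_cube c r0) ltry.
have v0 x : 0 <= v x by rewrite mulr_ge0.
(* By [v <= 1 + v ^+ n] on a cube of finite volume. *)
have iv : mu.-integrable (cube c r) (EFin \o v).
  have := integrableD mQ i1 ivn; apply: le_integrable => //.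
    by apply/measurable_EFinP.
  move=> x _ /=; rewrite lee_fin (ger0_norm (v0 x)) ger0_norm ?addr_ge0 ?exprn_ge0//.
  have [le1|gt1] := leP (v x) 1; first by rewrite ler_wpDr// exprn_ge0.
  by apply: ler_wpDl => //; rewrite ler_eXnr// ltW.
pose K := fine (\int[mu]_(x in cube c r) (v x ^+ n)%:E)%E.
have vK : (\int[mu]_(x in cube c r) (v x ^+ n)%:E <= K%:E)%E.
  by rewrite /K fineK//; exact: (integrable_fin_num mQ ivn).
apply: (@sum_norm_eq0_ae R n M c r K F G v r0 n0 _ _ iv _ vK).
- by move=> k; apply: integrable_cube1 => //; exact: F1.
- by move=> i k; apply: integrable_cube1 => //; exact: G1.
- by move=> x _.
- by move=> a b /weak_obox; exact.
- by move=> i; apply: filterS GW => x /[swap] /crO' Ox /(_ Ox).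
- by move=> m; have [rho rho0 H] := flat m; exists rho => // s /H.
Qed.

End local_uniqueness.

(** * Propagation through a connected open set *)

Section propagation.
Context {R : realType} {n : nat}.
Notation mu := (lebesgue_row R n).
Implicit Types (Omega E : set 'rV[R]_n) (c x y : 'rV[R]_n) (r s : R).

Definition ae_on_cube E c r := {ae mu, forall x, cube c r x -> E x}.

Lemma cube_cube c y r s : cube c s y -> cube y r `<=` cube c (r + s).
Proof.
move=> /in_cube cy x /in_cube yx; apply/in_cube => j.
rewrite -(subrK (y ord0 j) (x ord0 j)) -addrA.
by apply: le_lt_trans (ler_normD _ _) _; exact: ltrD.
Qed.

Lemma closed_cube_closed_cube c y r s : cube c s y ->
  closed_cube y r `<=` closed_cube c (r + s).
Proof.
move=> cy x yx j; have := cy j; have := yx j.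
by rewrite /= !in_itv /= => /andP[? ?] /andP[? ?]; apply/andP; split; lra.
Qed.

Lemma open_closed_cube Omega x : open Omega -> Omega x ->
  exists2 r, 0 < r & closed_cube x r `<=` Omega.
Proof.
move=> oO Ox; have /nbhs_ballP[e /= e0 xeO] := open_nbhs_nbhs (conj oO Ox).
exists (e / 2); first by rewrite divr_gt0.
apply: subset_trans xeO; rewrite -cube_ball// => y yx j; have := yx j.
by rewrite /= !in_itv /= => /andP[? ?]; apply/andP; split; lra.
Qed.

Lemma ae_on_cubeW E c y r s : cube y r `<=` cube c s -> ae_on_cube E c s -> ae_on_cube E y r.
Proof. by move=> sub; apply: filterS => x H /sub. Qed.

(** A Lindelof argument: every point lies in a rational box contained in its cube, and there are
    countably many such boxes. *)
Lemma ae_on_open Omega E : 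
  (forall x, Omega x -> exists2 r, 0 < r & ae_on_cube E x r) ->
  {ae mu, forall x, Omega x -> E x}.
Proof.
move=> H.
pose B (q : {ffun 'I_n -> rat * rat}) := [set x : 'rV[R]_n |
  forall i, `]ratr (q i).1, ratr (q i).2[%classic (x ord0 i)].
pose P q := {ae mu, forall x, B q x -> E x}.
(* Boxes are enumerated through [unpickle]. One on which [E] does not hold almost everywhere imposes
   nothing, so every index has a null exceptional set. *)
have HB (m : nat) : {ae mu, forall x, forall q, unpickle m = Some q -> P q -> B q x -> E x}.
  case Em: (unpickle m) => [q|]; last by apply: aeW.
  have [Pq|nPq] := pselect (P q); last by apply: aeW => x q' [<-].
  by apply: filterS Pq => x Bx q' [<-] _ /Bx.
have muF : Filter (almost_everywhere mu) by exact: ae_filter_ringOfSetsType.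
move: (ae_foralln HB); apply: (@filterS _ _ muF) => x Hx Ox.
have [r r0 xr] := H x Ox.
have /choice[q Hq] : forall i : 'I_n, exists p : rat * rat,
    (ratr p.1 \in `]x ord0 i - r, x ord0 i[) /\
    (ratr p.2 \in `]x ord0 i, x ord0 i + r[).
  move=> i.
  have /rat_in_itvoo[a ?] : x ord0 i - r < x ord0 i by rewrite gtrBl.
  have /rat_in_itvoo[b ?] : x ord0 i < x ord0 i + r by rewrite ltrDl.
  by exists (a, b).
apply: (Hx (pickle [ffun i => q i]) [ffun i => q i] (pickleK _)).
- apply: filterS xr => y yE By; apply: yE => i.
  have := By i; rewrite /= ffunE !in_itv /= => /andP[y1 y2].
  have [] := Hq i; rewrite !in_itv /= => /andP[q1 _] /andP[_ q2].
  by rewrite (lt_trans q1 y1) (lt_trans y2 q2).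
- move=> i; rewrite /= ffunE in_itv /=.
  by have [] := Hq i; rewrite !in_itv /= => /andP[_ ->] /andP[->].
Qed.

(** The points with a cube on which [E] holds form an open set. It is closed in [Omega] because
    around a nearby point [z] of it local uniqueness holds on a cube whose size depends only on the
    limit point, however small the cube first known at [z]. *)
Lemma connected_propagation Omega E (flat : 'rV[R]_n -> Prop) x0 :
  open Omega -> connected Omega ->
  (forall c r, 0 < r -> closed_cube c r `<=` Omega -> flat c -> ae_on_cube E c r) ->
  (forall c r, 0 < r -> ae_on_cube E c r -> flat c) ->
  Omega x0 -> flat x0 -> {ae mu, forall x, Omega x -> E x}.
Proof.
move=> oO cO LU FL Ox0 fx0.
pose Z := [set x | exists2 r, 0 < r & ae_on_cube E x r].
suff OZ : Omega `&` Z = Omega.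
  by apply: ae_on_open => x; rewrite -{1}OZ => -[].
apply: cO.
- exists x0; split => //; have [r rp rO] := open_closed_cube oO Ox0.
  by exists r => //; exact: LU.
- exists Z => //; rewrite openE => x [r rp xr]; apply/nbhs_ballP.
  exists (r / 2) => /=; first by rewrite divr_gt0.
  rewrite -cube_ball ?divr_gt0// => y xy; exists (r / 2); first by rewrite divr_gt0.
  by apply: ae_on_cubeW xr; rewrite [in X in _ `<=` X](splitr r); exact: cube_cube.
- exists (closure Z); first exact: closed_closure.
  apply/seteqP; split => y [Oy]; first by move=> Zy; split => //; exact: subset_closure.
  move=> cZy; split => //; have [r rp rO] := open_closed_cube oO Oy.
  (* For [z] within [r / 4] of [y], the cube of radius [r / 2] at [z] stays within [3 * r / 4] of
     [y] and contains the cube of radius [r / 4] at [y]. *)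
  have r4 : 0 < r / 4 by rewrite divr_gt0.
  have [z [[s s0 zs] yz]] := cZy _ (nbhsx_ballx y (r / 4) r4).
  move: yz; rewrite -cube_ball// => yz.
  have zr : closed_cube z (r / 2) `<=` Omega.
    apply: subset_trans rO; apply: subset_trans (closed_cube_closed_cube yz) _.
    by move=> x xz j; have := xz j; rewrite /= !in_itv /= => /andP[? ?]; apply/andP; split; lra.
  have zy : cube z (r / 4) y by apply/in_cube => j; rewrite distrC; exact: (in_cube _ _ _).1.
  exists (r / 4) => //; apply: ae_on_cubeW (LU _ _ _ zr (FL _ _ s0 zs)); last first.
    by rewrite divr_gt0.
  by have := cube_cube (r := r / 4) zy; rewrite (_ : r / 4 + r / 4 = r / 2)//; lra.
Qed.

End propagation.

(** * Infinite order of vanishing on cubes *)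

Section flatness.
Context {R : realType} {n M : nat}.
Notation mu := (lebesgue_row R n).
Variables (F : 'I_M -> 'rV[R]_n -> R).
Hypothesis mF : forall k, measurable_fun setT (F k).
Local Notation U x := (\sum_k `|F k x|).

Let mU D : measurable_fun D (fun x => U x).
Proof.
by apply: measurable_sum => k; apply: measurableT_comp => //; exact: measurable_funTS (mF k).
Qed.

Lemma flat_at_ae_eq0 c r : 0 < r -> ae_on_cube [set x | U x = 0] c r -> flat_at F c.
Proof.
move=> r0 c0 m; exists r => // s /andP[s0 sr].
rewrite (@ae_eq_integral_nomeas _ _ _ mu _ _ (cst 0%E)).
  by rewrite integral0 lee_fin exprn_ge0// ltW.
apply: filterS c0 => x Ux xs; rewrite Ux ?expr0n//.
by apply: subset_cube xs; exact: ltW.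
Qed.

Lemma flat_at_vanishing (Omega : set 'rV[R]_n) (u : 'rV[R]_n -> 'rV[R]_M) x0 :
  (0 < n)%N -> (0 < M)%N -> open Omega -> Omega x0 ->
  {ae mu, forall x, Omega x -> forall k, u x ord0 k = F k x} ->
  vanishes_to_infinite_order u x0 -> flat_at F x0.
Proof.
move=> n0 M0 oO Ox0 uF van m.
have n0R : (0 : R) < n%:R by rewrite ltr0n.
have M0R : (0 : R) < M%:R by rewrite ltr0n.
(* Two losses are compensated: [U <= M%:R * enorm (u x)] is squared, and the cube of radius [s] sits
   in the Euclidean ball of radius [n%:R * s]. *)
pose e : R := (M%:R ^+ 2 * n%:R ^+ m)^-1.
have e0 : 0 < e by rewrite invr_gt0 mulr_gt0 ?exprn_gt0.
have [r rp rO] := open_closed_cube oO Ox0.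
have : \forall t \near (0 : R)^'+,
    (((t ^- m)%:E * \int[mu]_(x in eball x0 t) (enorm (u x) ^+ 2)%:E) < e%:E)%E.
  have lt0e : nbhs (0%E : \bar R) [set z | (z < e%:E)%E].
    by apply: open_nbhs_nbhs; split; [exact: open_ereal_lt_ereal|rewrite /= lte_fin].
  exact: (van m _ lt0e).
move=> /nbhs_ballP[d /= d0 H].
pose t s : R := n%:R * s.
exists (Num.min (d / n%:R) r) => [|s /andP[s0]]; first by rewrite lt_min rp divr_gt0.
rewrite lt_min => /andP[sd sr].
have ts0 : 0 < t s by rewrite mulr_gt0.
have {}H : ((t s ^- m)%:E * \int[mu]_(x in eball x0 (t s)) (enorm (u x) ^+ 2)%:E < e%:E)%E.
  apply: H => //; rewrite /ball /= sub0r normrN gtr0_norm//.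
  by rewrite /t mulrC -ltr_pdivlMr.
set X := (\int[mu]_(x in eball x0 (t s)) _)%E in H.
have {}H : (X <= (e * t s ^+ m)%:E)%E.
  have tm : 0 < t s ^+ m by rewrite exprn_gt0.
  rewrite -(@lee_pmul2l _ (t s ^- m)%:E)//; last by rewrite lte_fin invr_gt0.
  by apply: (le_trans (ltW H)); rewrite -EFinM mulrCA mulVf ?mulr1// gt_eqF.
have M2 : (0 : R) < M%:R ^- 2 by rewrite invr_gt0 exprn_gt0.
rewrite -(@lee_pmul2l _ (M%:R ^- 2)%:E)//.
have mUE : measurable_fun (cube x0 s) (fun x => (U x ^+ 2)%:E).
  by apply/measurable_EFinP; exact: measurable_funX.
rewrite -ge0_integralZl//; last 2 first.
- exact: measurable_cube.
- by move=> x _; rewrite lee_fin sqr_ge0.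
apply: (@le_trans _ _ X); last first.
  have nm : n%:R ^+ m != 0 :> R by rewrite expf_neq0// gt_eqF.
  apply: (le_trans H); rewrite -EFinM lee_fin /e /t exprMn invfM.
  by rewrite mulrA -[_ * _ * n%:R ^+ m]mulrA mulVf// mulr1.
(* The given [u] need not be Borel, so the integrals are compared pointwise off a null set. *)
rewrite /X integral_mkcond [leRHS]integral_mkcond.
have [N [mN N0 HN]] := uF.
apply: (ge0_integral_le_off_null mN N0).
- by move=> x; rewrite patchE; case: ifP => // _; rewrite mule_ge0// lee_fin ?sqr_ge0// ltW.
- by move=> x; rewrite patchE; case: ifP => // _; rewrite lee_fin sqr_ge0.
move=> x Nx; rewrite [leLHS]patchE; case: ifPn => [/set_mem xs|_]; last first.
  by rewrite patchE; case: ifP => // _; rewrite lee_fin sqr_ge0.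
rewrite patchE mem_set; last exact: (cube_eball s0 n0 xs).
have Ox : Omega x.
  by apply: rO; apply: obox_cbox; apply: subset_cube xs; exact: ltW.
have uFx k : u x ord0 k = F k x.
  by move: Ox k; apply: contrapT => h; apply: Nx; apply: HN.
rewrite -EFinM lee_fin (eq_bigr (fun k => `|u x ord0 k|)); last by move=> k _; rewrite uFx.
rewrite ler_pdivrMl ?exprn_gt0// -exprMn lerXn2r ?nnegrE ?sumr_ge0//.
- by rewrite mulr_ge0// enorm_ge0.
- exact: enorm_row_ge.
Qed.

End flatness.

(** * Strong unique continuation *)

Theorem theorem1p1 (R : realType) (n M : nat) (hn : (2 <= n)%N) (hM : (0 < M)%N)
    (Omega : set 'rV[R]_n) (Omega_open : open Omega)
    (Omega_connected : connected Omega)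
    (V : 'rV[R]_n -> R) (V_Ln : Lp_loc n Omega V)
    (u : 'rV[R]_n -> 'rV[R]_M)
    (u_H1 : forall k : 'I_M, H1_loc Omega (fun x => u x ord0 k))
    (Du : 'rV[R]_n -> 'M[R]_(n, M)) (u_grad : is_weak_gradient Omega u Du)
    (Du_le : {ae lebesgue_row R n, forall x, Omega x ->
       enorm (Du x) <= V x * enorm (u x)})
    (x0 : 'rV[R]_n) (Omega_x0 : Omega x0)
    (u_x0 : vanishes_to_infinite_order u x0) :
  {ae lebesgue_row R n, forall x, Omega x -> u x = 0}.
Proof.
have n0 : (0 < n)%N by exact: ltnW.
have mO : measurable Omega by exact: open_measurable_row.
have muF : Filter (almost_everywhere (lebesgue_row R n)) by exact: ae_filter_ringOfSetsType.
have /choice[F HF] : forall k, exists F : 'rV[R]_n -> R, measurable_fun setT F /\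
    ae_eq (lebesgue_row R n) Omega (fun x => u x ord0 k) F.
  move=> k; have [[/(borel_version mO)[F mF uF] _] _] := u_H1 k.
  by exists F.
have /choice[G HG] : forall j, exists G : 'I_M -> 'rV[R]_n -> R, forall k,
    measurable_fun setT (G k) /\ ae_eq (lebesgue_row R n) Omega (fun x => Du x j k) (G k).
  move=> j; have /choice[G HG] : forall k, exists G : 'rV[R]_n -> R, measurable_fun setT G /\
      ae_eq (lebesgue_row R n) Omega (fun x => Du x j k) G.
    by move=> k; have [_ [/(borel_version mO)[g mg ug] _] _] := u_grad j k; exists g.
  by exists G.
have [W mW VW] := borel_version mO V_Ln.1.
have uF : {ae lebesgue_row R n, forall x, Omega x -> forall k, u x ord0 k = F k x}.
  have : {ae lebesgue_row R n, forall x, forall k, Omega x -> u x ord0 k = F k x}.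
    by apply: filter_forall => k; have [_] := HF k.
  by apply: filterS => x H Ox k; exact: H.
have DG : {ae lebesgue_row R n, forall x, forall j k, Omega x -> Du x j k = G j k x}.
  by apply: filter_forall => j; apply: filter_forall => k; have [_] := HG j k.
have GW : {ae lebesgue_row R n, forall x, Omega x -> forall i,
    \sum_k `|G i k x| <= M%:R * `|W x| * \sum_k `|F k x|}.
  have := @filterI _ _ muF _ _ (@filterI _ _ muF _ _ uF DG) (@filterI _ _ muF _ _ VW Du_le).
  apply: (@filterS _ _ muF) => x [[uFx DGx] [VWx Dux]] Ox i.
  (* Each of the [M] entries of row [i] is at most [enorm (Du x)], whence the factor [M]. The
     modulus of [W x] replaces [V x], whose sign is not prescribed. *)
  rewrite -mulrA mulr_natl.
  apply: (@le_trans _ _ (\sum_(k < M) (enorm (Du x)))).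
    by apply: ler_sum => k _; rewrite -DGx//; exact: norm_le_enorm.
  rewrite sumr_const card_ord; apply: ler_wMn2r.
  apply: le_trans (Dux Ox) _; rewrite (VWx Ox).
  rewrite (eq_bigr (fun k => `|u x ord0 k|)); last by move=> k _; rewrite uFx.
  apply: (@le_trans _ _ (`|W x| * enorm (u x))).
    by rewrite ler_wpM2r ?enorm_ge0// ler_norm.
  by rewrite ler_wpM2l// enorm_row_le.
(* Any direction will do: it only serves to read local integrability of [u] off
   [is_weak_partial]. *)
have j0 : 'I_n := Ordinal n0.
have F1 k K : compact K -> K `<=` Omega ->
    (\int[lebesgue_row R n]_(x in K) (`|F k x| ^+ 1)%:E < +oo)%E.
  by have [uL _ _] := u_grad j0 k; exact: (Lp_loc_ae_eq uL (HF k).2).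
have G1 j k K : compact K -> K `<=` Omega ->
    (\int[lebesgue_row R n]_(x in K) (`|G j k x| ^+ 1)%:E < +oo)%E.
  by have [_ gL _] := u_grad j k; exact: (Lp_loc_ae_eq gL (HG j k).2).
have Wn := Lp_loc_ae_eq V_Ln VW.
have weak j k phi : test_function Omega phi ->
    (\int[lebesgue_row R n]_(x in Omega) (F k x * partial j phi x)%:E =
     - \int[lebesgue_row R n]_(x in Omega) (G j k x * phi x)%:E)%E.
  move=> tphi; have [_ _ /(_ phi tphi)] := u_grad j k.
  rewrite (@ae_eq_integral_nomeas _ _ _ _ _ _ (fun x => (F k x * partial j phi x)%:E)).
    move=> ->; rewrite (@ae_eq_integral_nomeas _ _ _ _ _ _ (fun x => (G j k x * phi x)%:E))//.
    by apply: filterS (HG j k).2 => x + Ox => /(_ Ox) ->.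
  by apply: filterS (HF k).2 => x + Ox => /(_ Ox) ->.
have mF k : measurable_fun setT (F k) by have [] := HF k.
have mG j k : measurable_fun setT (G j k) by have [] := HG j k.
have U0 : {ae lebesgue_row R n, forall x, Omega x -> [set x | \sum_k `|F k x| = 0] x}.
  apply: (@connected_propagation _ _ _ _ (flat_at F) x0) => //.
  - by move=> c r; exact: (local_uniqueness n0 mF mG mW F1 G1 Wn weak GW).
  - by move=> c r; exact: flat_at_ae_eq0.
  - exact: flat_at_vanishing uF u_x0.
move: (@filterI _ _ muF _ _ U0 uF); apply: (@filterS _ _ muF) => x [Ux uFx] Ox.
apply/rowP => k; rewrite mxE uFx//; apply/normr0_eq0.
have := Ux Ox => /= /eqP; rewrite psumr_eq0// => /allP/(_ k).
by rewrite mem_index_enum => /(_ isT)/eqP.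
Qed.
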